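(* Let $r\geq 2$ be an integer and let $\mathfrak{X}_r=\mathrm{SL}(3,\mathbb{C})^{\times r}/\!\!/\mathrm{SL}(3,\mathbb{C})$. Define the following sets of elements of $\mathbb{C}[\mathfrak{X}_r]$: $$\mathcal{A}=\{\mathrm{tr}(\mathbf{X}_1),\ \mathrm{tr}(\mathbf{X}_2),\ \mathrm{tr}(\mathbf{X}_1^{-1}),\ \mathrm{tr}(\mathbf{X}_2^{-1}),\ \mathrm{tr}(\mathbf{X}_1\mathbf{X}_2),\ \mathrm{tr}(\mathbf{X}_1^{-1}\mathbf{X}_2),\ \mathrm{tr}(\mathbf{X}_2^{-1}\mathbf{X}_1),\ \mathrm{tr}(\mathbf{X}_1^{-1}\mathbf{X}_2^{-1})\},$$ $$\mathcal{B}=\bigcup_{k=3}^{r}\{\mathrm{tr}(\mathbf{X}_k),\ \mathrm{tr}(\mathbf{X}_k^{-1}),\ \mathrm{tr}(\mathbf{X}_1\mathbf{X}_k),\ \mathrm{tr}(\mathbf{X}_2\mathbf{X}_k),\ \mathrm{tr}(\mathbf{X}_1\mathbf{X}_k^{-1})\},$$ and let $\mathcal{C}$ be any one of the following five sets: $$\mathcal{C}_1=\bigcup_{k=3}^{r}\{\mathrm{tr}(\mathbf{X}_1^{-1}\mathbf{X}_k^{-1}),\ \mathrm{tr}(\mathbf{X}_1^{-1}\mathbf{X}_k),\ \mathrm{tr}(\mathbf{X}_2^{-1}\mathbf{X}_k^{-1})\},$$ $$\mathcal{C}_2=\bigcup_{k=3}^{r}\{\mathrm{tr}(\mathbf{X}_1^{-1}\mathbf{X}_k^{-1}),\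 \mathrm{tr}(\mathbf{X}_1^{-1}\mathbf{X}_k),\ \mathrm{tr}(\mathbf{X}_2^{-1}\mathbf{X}_k)\},$$ $$\mathcal{C}_3=\bigcup_{k=3}^{r}\{\mathrm{tr}(\mathbf{X}_1^{-1}\mathbf{X}_k^{-1}),\ \mathrm{tr}(\mathbf{X}_1^{-1}\mathbf{X}_k),\ \mathrm{tr}(\mathbf{X}_2\mathbf{X}_k^{-1})\},$$ $$\mathcal{C}_4=\bigcup_{k=3}^{r}\{\mathrm{tr}(\mathbf{X}_1^{-1}\mathbf{X}_k),\ \mathrm{tr}(\mathbf{X}_2^{-1}\mathbf{X}_k),\ \mathrm{tr}(\mathbf{X}_2\mathbf{X}_k^{-1})\},$$ $$\mathcal{C}_5=\bigcup_{k=3}^{r}\{\mathrm{tr}(\mathbf{X}_1^{-1}\mathbf{X}_k^{-1}),\ \mathrm{tr}(\mathbf{X}_2\mathbf{X}_k^{-1}),\ \mathrm{tr}(\mathbf{X}_2^{-1}\mathbf{X}_k^{-1})\}.$$ (For $r=2$ the sets $\mathcal{B}$ and $\mathcal{C}$ are empty.) Then, in each of the five cases, the elements of $\mathcal{A}\cup\mathcal{B}\cup\mathcal{C}$ are local parameters of $\mathfrak{X}_r$ at generic smooth points. In all cases $\mathcal{A}\cup\mathcal{B}\cup\mathcal{C}$ has exactly $8r-8$ elements, which is the Krull dimension of $\mathfrak{X}_r$, and consequently $\mathcal{A}\cup\mathcal{B}\cup\mathcal{C}$ is a maximal algebraically independent subset (over $\mathbb{C}$) of $\mathbb{C}[\m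athfrak{X}_r]$.
   Context: The group $\mathrm{SL}(3,\mathbb{C})$ acts on the affine variety $\mathrm{SL}(3,\mathbb{C})^{\times r}$ by simultaneous conjugation, $g\cdot(A_1,\dots,A_r)=(gA_1g^{-1},\dots,gA_rg^{-1})$. The character variety $\mathfrak{X}_r=\mathrm{SL}(3,\mathbb{C})^{\times r}/\!\!/\mathrm{SL}(3,\mathbb{C})$ is the affine variety (maximal spectrum) with coordinate ring $\mathbb{C}[\mathfrak{X}_r]=\mathbb{C}[\mathrm{SL}(3,\mathbb{C})^{\times r}]^{\mathrm{SL}(3,\mathbb{C})}$. For $1\leq k\leq r$, $\mathbf{X}_k$ denotes the generic unimodular $3\times 3$ matrix of the $k$-th factor, i.e. the matrix whose entries are the coordinate functions $x^k_{ij}$ on the $k$-th copy of $\mathrm{SL}(3,\mathbb{C})$. For a word $w$ in $\mathbf{X}_1^{\pm1},\dots,\mathbf{X}_r^{\pm1}$, $\mathrm{tr}(w)\in\mathbb{C}[\mathfrak{X}_r]$ is the invariant function $(A_1,\dots,A_r)\mapsto \mathrm{tr}(w(A_1,\dots,A_r))$. All the functions listed in the statement belong to a known minimal generating set of the algebra $\mathbb{C}[\mathfrak{X}_r]$, which consists of all $\mathrm{tr}(\mathbf{X}_i^{\pm1})$, all $\mathrm{tr}(\mathbf{X}_i^{\pm1}\mathbf{X}_j^{\pm1})$ with $i\neq j$, and certain traces of longer words. A set of functions $\{f_1,\dots,f_d\}\subset\mathbb{C}[X]$ on an affine variety $X$ of dimension $d$ is a set of local parameters at a smooth point $p$ if the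 differentials of $f_i-f_i(p)$ at $p$ form a basis of the cotangent space $T_p^*(X)$. ''At generic smooth points'' means: at all points of some non-empty Zariski open subset of the smooth locus of $X$. *)

(* Defs.v *)
From HB Require Import structures.
From mathcomp Require Import all_boot all_order all_algebra ring_quotient.
From mathcomp Require Import complex boolp classical_sets functions cardinality.
From mathcomp Require Import reals mpoly.

Set Implicit Arguments.
Unset Strict Implicit.
Unset Printing Implicit Defensive.

Import Order.TTheory GRing.Theory Num.Theory.
Local Open Scope classical_set_scope.
Local Open Scope ring_scope.

(* A is meant to be the coordinate ring of an irreducible affine variety over *)
(* the algebraically closed field K; its points are the maximal ideals of A.  *)
Section AffineVariety.
Variables (K : closedFieldType) (A : comAlgType K).

Definition prime_chain (n : nat) (P : nat -> {pred A}) : Prop :=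
  (forall i, (i <= n)%N -> idealr_closed (P i) /\ prime_idealr_closed (P i)) /\
  (forall i, (i < n)%N ->
     {subset P i <= P i.+1} /\ exists2 f, f \in P i.+1 & f \notin P i).

Definition krull_dim (d : nat) : Prop :=
  (exists P, prime_chain d P) /\
  (forall n P, prime_chain n P -> (n <= d)%N).

(* [idealr_closed] includes properness: 1 is not in the ideal. *)
Definition maximal_ideal (m : {pred A}) : Prop :=
  idealr_closed m /\
  forall J : {pred A}, idealr_closed J -> {subset m <= J} -> {subset J <= m}.

Record max_spec := MaxSpec {
  ideal_of :> A -> bool;
  ideal_ofP : maximal_ideal ideal_of }.

Definition zariski_open (U : set max_spec) : Prop :=
  exists E : set A, U = [set p : max_spec | exists2 f, E f & f \notin (p : {pred A})].

Definition ideal_square (m : {pred A}) : set A :=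
  [set h | exists n (a b : 'I_n -> A),
    [/\ forall i, a i \in m, forall i, b i \in m & h = \sum_i a i * b i]].

(* The classes of the g i form a K-basis of the cotangent space m / m^2; K is *)
(* the residue field A / m, because K is algebraically closed.                *)
Definition cotangent_basis (m : {pred A}) (n : nat) (g : 'I_n -> A) : Prop :=
  [/\ forall i, g i \in m,
      forall h, h \in m ->
        exists c : 'I_n -> K, ideal_square m (h - \sum_i c i *: g i)
    & forall c : 'I_n -> K,
        ideal_square m (\sum_i c i *: g i) -> forall i, c i = 0].

(* dim T_p^* = dim X.  As X is irreducible, it has dimension dim X at every   *)
(* point, so there is no need to localise.                                    *)
Definition smooth_locus : set max_spec :=
  [set p : max_spec | exists d (g : 'I_d -> A), krull_dim d /\ cotangent_basis p g].

(* The value f(p) is the unique scalar c with f - c in the ideal p. *)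
Definition value_at (p : max_spec) (f : A) (c : K) : Prop :=
  f - c%:A \in (p : {pred A}).

Definition local_parameters (p : max_spec) (S : set A) : Prop :=
  exists d (f : 'I_d -> A) (v : 'I_d -> K),
    [/\ krull_dim d, injective f, range f = S,
        forall i, value_at p (f i) (v i)
      & cotangent_basis p (fun i => f i - (v i)%:A)].

(* The open subsets of the smooth locus are those of the form U `&` smooth    *)
(* with U open in X.                                                          *)
Definition generic_local_parameters (S : set A) : Prop :=
  exists U : set max_spec,
    [/\ zariski_open U, U `&` smooth_locus !=set0
      & forall p, (U `&` smooth_locus) p -> local_parameters p S].

Definition alg_independent (S : set A) : Prop :=
  forall n (f : 'I_n -> A), injective f -> (forall i, S (f i)) ->
  forall P : {mpoly K[n]}, mmap (in_alg A) f P = 0 -> P = 0.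

Definition maximal_alg_independent (S : set A) : Prop :=
  alg_independent S /\
  forall S' : set A, S `<=` S' -> alg_independent S' -> S' `<=` S.

End AffineVariety.

Section SpecialLinear.
Variable R : realType.

Definition SL3 := {M : 'M[R[i]]_3 | \det M == 1}.

Lemma SL3_unit (g : SL3) : val g \in unitmx.
Proof. by rewrite unitmxE (eqP (valP g)) unitr1. Qed.

Lemma SL3_conj_subproof (g M : SL3) :
  \det (val g *m val M *m invmx (val g)) == 1.
Proof.
by rewrite !det_mulmx det_inv (eqP (valP g)) (eqP (valP M)) invr1 !mulr1.
Qed.

Definition SL3_conj (g M : SL3) : SL3 :=
  exist (fun N : 'M[R[i]]_3 => \det N == 1) _ (SL3_conj_subproof g M).

End SpecialLinear.

Section CharacterVariety.
Variables (R : realType) (r : nat).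

Definition SL3r := 'I_r -> SL3 R.

Definition coord := ('I_r * 'I_3 * 'I_3)%type.

Definition coord_values (M : SL3r) (x : 'I_#|{: coord}|) : R[i] :=
  let: (k, i, j) := enum_val x in val (M k) i j.

(* SL3^r is closed and reduced, so C[SL3^r] is the ring of functions on it    *)
(* that are polynomial in the matrix entries.                                 *)
Definition regular (f : SL3r -> R[i]^o) : Prop :=
  exists P : {mpoly R[i][#|{: coord}|]}, forall M, f M = P.@[coord_values M].

Definition conj_invariant (f : SL3r -> R[i]^o) : Prop :=
  forall (g : SL3 R) (M : SL3r), f (fun k => SL3_conj g (M k)) = f M.

Definition char_fun : {pred SL3r -> R[i]^o} :=
  [pred f | `[< regular f /\ conj_invariant f >]].

Lemma char_funP f : reflect (regular f /\ conj_invariant f) (f \in char_fun).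
Proof. exact: asboolP. Qed.

Lemma char_fun_subring : subring_closed char_fun.
Proof.
split.
- apply/char_funP; split; last by [].
  by exists 1 => M; rewrite meval1.
- move=> f g /char_funP[[P fP] fI] /char_funP[[Q gQ] gI].
  apply/char_funP; split.
    by exists (P - Q) => M; rewrite mevalB -fP -gQ.
  by move=> u M; rewrite !fctE /= fI gI.
- move=> f g /char_funP[[P fP] fI] /char_funP[[Q gQ] gI].
  apply/char_funP; split.
    by exists (P * Q) => M; rewrite mevalM -fP -gQ.
  by move=> u M; rewrite !fctE /= fI gI.
Qed.

Lemma char_fun_scaler : GRing.scaler_closed char_fun.
Proof.
move=> c f /char_funP[[P fP] fI]; apply/char_funP; split.
  by exists (c *: P) => M; rewrite mevalZ -fP.
by move=> u M; rewrite !fctE /= fI.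
Qed.

HB.instance Definition _ :=
  GRing.isSubringClosed.Build _ char_fun char_fun_subring.
HB.instance Definition _ :=
  GRing.isScaleClosed.Build _ _ char_fun char_fun_scaler.

(* C[X_r] = C[SL3^r]^SL3 *)
Record char_ring := CharRing {
  char_ring_val :> SL3r -> R[i]^o;
  _ : char_ring_val \in char_fun }.

HB.instance Definition _ := [isSub for char_ring_val].
HB.instance Definition _ := [Choice of char_ring by <:].
HB.instance Definition _ :=
  GRing.SubChoice_isSubComPzRing.Build _ _ char_ring char_fun_subring.
HB.instance Definition _ := [SubZmodule_isSubLmodule of char_ring by <:].

Lemma SL3_1_subproof : \det (1%:M : 'M[R[i]]_3) == 1.
Proof. by rewrite det1. Qed.

Lemma char_ring_1_neq0 : (1 : char_ring) != 0.
Proof.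
apply/eqP => /(congr1 (fun f : char_ring =>
  f (fun=> exist (fun N : 'M[R[i]]_3 => \det N == 1) _ SL3_1_subproof))).
exact/eqP/oner_neq0.
Qed.

HB.instance Definition _ :=
  GRing.PzSemiRing_isNonZero.Build char_ring char_ring_1_neq0.

Lemma char_ring_scalerAl (c : R[i]) (f g : char_ring) :
  c *: (f * g) = (c *: f) * g.
Proof. by apply/val_inj/funext => M; apply: (mulrA c). Qed.

HB.instance Definition _ :=
  GRing.Lmodule_isLalgebra.Build R[i] char_ring char_ring_scalerAl.
HB.instance Definition _ :=
  GRing.Lalgebra_isComAlgebra.Build R[i] char_ring.

(* A word in X_1^{+-1}, ..., X_r^{+-1}; the boolean marks an inverse and      *)
(* 'I_r is 0-based.                                                           *)
Definition word := seq ('I_r * bool).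

Definition word_eval (M : SL3r) (w : word) : 'M[R[i]]_3 :=
  \prod_(l <- w) (if l.2 then invmx (val (M l.1)) else val (M l.1)).

Definition generic_mx (k : 'I_r) : 'M[{mpoly R[i][#|{: coord}|]}]_3 :=
  \matrix_(i, j) 'X_(enum_rank ((k, i, j) : coord)).

Lemma trace_word_subproof (w : word) :
  (fun M => \tr (word_eval M w) : R[i]^o) \in char_fun.
Proof.
apply/char_funP; split.
  exists (\tr (\prod_(l <- w)
    (if l.2 then \adj (generic_mx l.1) else generic_mx l.1))) => M.
  have genE k : map_mx (meval (coord_values M)) (generic_mx k) = val (M k).
    by apply/matrixP => i j; rewrite !mxE mevalXU /coord_values enum_rankK.
  rewrite -trace_map_mx rmorph_prod /=; congr (\tr _).
  apply: eq_bigr => -[k []] _ /=; last by rewrite genE.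
  rewrite map_mx_adj genE /invmx SL3_unit (eqP (valP (M k))).
  by rewrite invr1 scale1r.
move=> g M.
have gU := SL3_unit g.
have -> : word_eval (fun k => SL3_conj g (M k)) w =
    val g *m word_eval M w *m invmx (val g).
  elim: w => [|[k b] w IH]; rewrite /word_eval ?big_nil ?big_cons.
    by rewrite mulmx1 mulmxV.
  move: IH; rewrite /word_eval => ->.
  set W := \prod_(l <- w) _; rewrite -!mulmxE.
  case: b => /=; rewrite !mulmxA.
    have -> : invmx (val g *m val (M k) *m invmx (val g)) =
        val g *m invmx (val (M k)) *m invmx (val g).
      have MU := SL3_unit (M k).
      rewrite -[LHS]mulmx1; apply: (canLR (mulKmx _)).
        by rewrite !unitmx_mul gU MU unitmx_inv gU.
      by rewrite !mulmxA mulmxKV // mulmxK // mulmxV.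
    by rewrite mulmxKV // -!mulmxA.
  by rewrite mulmxKV // -!mulmxA.
by rewrite mxtrace_mulC mulmxA mulVmx // mul1mx.
Qed.

Definition tr (w : word) : char_ring := CharRing (trace_word_subproof w).

Definition X (k : 'I_r) : 'I_r * bool := (k, false).
Definition Xinv (k : 'I_r) : 'I_r * bool := (k, true).

Section ParameterSets.
Variable r_ge2 : (2 <= r)%N.

Definition i1 : 'I_r := Ordinal (ltnW r_ge2).
Definition i2 : 'I_r := Ordinal r_ge2.

Definition from3 : set 'I_r := [set k | (2 <= k)%N].

Definition calA : set char_ring :=
  [set tr [:: X i1]; tr [:: X i2]; tr [:: Xinv i1]; tr [:: Xinv i2];
       tr [:: X i1; X i2]; tr [:: Xinv i1; X i2];
       tr [:: Xinv i2; X i1]; tr [:: Xinv i1; Xinv i2]].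

Definition calB : set char_ring :=
  \bigcup_(k in from3)
    [set tr [:: X k]; tr [:: Xinv k]; tr [:: X i1; X k]; tr [:: X i2; X k];
         tr [:: X i1; Xinv k]].

Definition calC1 : set char_ring :=
  \bigcup_(k in from3)
    [set tr [:: Xinv i1; Xinv k]; tr [:: Xinv i1; X k];
         tr [:: Xinv i2; Xinv k]].

Definition calC2 : set char_ring :=
  \bigcup_(k in from3)
    [set tr [:: Xinv i1; Xinv k]; tr [:: Xinv i1; X k]; tr [:: Xinv i2; X k]].

Definition calC3 : set char_ring :=
  \bigcup_(k in from3)
    [set tr [:: Xinv i1; Xinv k]; tr [:: Xinv i1; X k]; tr [:: X i2; Xinv k]].

Definition calC4 : set char_ring :=
  \bigcup_(k in from3)
    [set tr [:: Xinv i1; X k]; tr [:: Xinv i2; X k]; tr [:: X i2; Xinv k]].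

Definition calC5 : set char_ring :=
  \bigcup_(k in from3)
    [set tr [:: Xinv i1; Xinv k]; tr [:: X i2; Xinv k];
         tr [:: Xinv i2; Xinv k]].

End ParameterSets.
End CharacterVariety.

(* Main.v *)
Require Import Defs.
From HB Require Import structures.
From mathcomp Require Import all_boot all_order all_algebra.
From mathcomp Require Import complex boolp classical_sets functions cardinality.
From mathcomp Require Import reals mpoly ring_quotient ring zify.
From mathcomp Require lebesgue_measure.
Set Implicit Arguments.
Unset Strict Implicit.
Unset Printing Implicit Defensive.

Import Order.TTheory GRing.Theory Num.Theory.
Local Open Scope classical_set_scope.
Local Open Scope ring_scope.

(* The traces are functions f_1, ..., f_n with n = 8r - 8 in A = C[X_r], and   *)
(* two ingredients suffice. First, a polynomial slice C^n -> SL3^r through    *)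
(* pairs in cyclic normal form meets the orbit of a generic point, so that A  *)
(* embeds into C[y_1, ..., y_n]. Second, right multiplication by              *)
(* infinitesimal 1 + e W, where W is the traceless part of a word in the X_k, *)
(* yields derivations D_1, ..., D_n of A such that J = det (D_j f_i) is       *)
(* nonzero at an integer point. The derivations make the f_i algebraically    *)
(* independent, and independent modulo m^2 at each maximal ideal m with       *)
(* J not in m; the embedding bounds the Krull dimension and the size of an    *)
(* algebraically independent set by n. As A has countable dimension and C is  *)
(* uncountable, some point of the slice avoids the separants of the           *)
(* algebraic relations of all elements of A over the f_i; Taylor expansion    *)
(* shows that it lies over a smooth point where J does not vanish.            *)

(** * Polynomial relations and derivations *)

(** Put n = 8r - 8 and let f_1, ..., f_n be the listed traces. The theorem is an instance of
    [generic_parameters], which concerns any commutative algebra A over an uncountable algebraically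
    closed field of characteristic 0 that has an injective morphism phi into a polynomial ring in n
    > 0 variables and n derivations D_j with J = det (D_j f_i) nonzero.

    Upper bounds come from phi: more than n polynomials in n variables are dependent
    ([algebraic_dependence]), while a chain of m + 1 primes yields m independent elements
    ([prime_chain_leq]). Independence comes from the derivations: applying the D_j to a relation and
    multiplying by the adjugate of the Jacobian lowers its degree ([jacobian_aindep]). As a
    derivation maps m^2 into m, the same linear algebra shows that the f_i minus their values are
    independent in m / m^2 wherever J does not vanish ([jac_free]); at a smooth point that space has
    dimension n, so they form a basis. A smooth point with J nonzero exists by [smooth_point]:
    countably many elements span A, each satisfies a separable relation over the f_i, and where no
    separant vanishes its differential is a combination of those of the f_i.

    For A = C[X_r], phi is the restriction to a polynomial slice. It is injective ([restrict_inj])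
    because a generic tuple becomes normal in the basis v, X_1 v, X_1^2 v with v an eigenvector of
    X_1 + X_2 ([conj_normal_pair]), and a generic normal tuple lies on the slice
    ([normal_pair_slice]); [regular_eq0] passes from generic tuples to all. Each D_j moves one X_k
    along the traceless part of a word ([derive_char_derivation]). Derivations moving X_k with k > 2
    kill the traces that do not involve X_k, so the Jacobian is block triangular with 8 by 8 blocks.
    At an integer point with X_3 = ... = X_r only two different blocks occur in each case, and
    integer certificates show that they are invertible ([block_checkP], [jacobian_family]). *)

Section PolynomialRelations.
Variable K : fieldType.

(** Constants and variables generate the polynomial ring, so identities between evaluations need
    checking on generators only. *)
Lemma mpoly_ring_ind n (T : {mpoly K[n]} -> Prop) :
  (forall c, T c%:MP) -> (forall i, T 'X_i) ->
  (forall p q, T p -> T q -> T (p + q)) ->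
  (forall p q, T p -> T q -> T (p * q)) -> forall p, T p.
Proof.
move=> TC TX TD TM; elim/mpolyind => [|c m p _ _ Tp]; first exact: (TC 0).
apply: (TD _ _ _ Tp); rewrite -mul_mpolyC; apply: (TM _ _ (TC c)).
rewrite mpolyXE_id; elim/big_ind: _ => // [|i _]; first exact: (TC 1).
elim: (m i) => [|e IH]; first exact: (TC 1).
by rewrite exprS; exact: TM.
Qed.

Section Evaluation.
Variables (B : comAlgType K) (n : nat) (f : 'I_n -> B).

Definition aeval (P : {mpoly K[n]}) : B := mmap (in_alg B) f P.

Lemma aevalC c : aeval c%:MP = c%:A.
Proof. exact: mmapC. Qed.

Lemma aevalX i : aeval 'X_i = f i.
Proof. by rewrite /aeval mmapX mmap1U. Qed.

Lemma aeval0 : aeval 0 = 0.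
Proof. exact: mmap0. Qed.

Lemma aeval1 : aeval 1 = 1.
Proof. exact: rmorph1. Qed.

Lemma aevalD p q : aeval (p + q) = aeval p + aeval q.
Proof. exact: mmapD. Qed.

Lemma aevalB p q : aeval (p - q) = aeval p - aeval q.
Proof. exact: mmapB. Qed.

Lemma aevalM p q : aeval (p * q) = aeval p * aeval q.
Proof. exact: rmorphM. Qed.

Lemma aevalZ c p : aeval (c *: p) = c *: aeval p.
Proof. by rewrite -mul_mpolyC aevalM aevalC -scalerAl mul1r. Qed.

End Evaluation.

Definition derivation (B : comAlgType K) (D : B -> B) :=
  [/\ forall a b, D (a + b) = D a + D b, forall c a, D (c *: a) = c *: D a
    & forall a b, D (a * b) = a * D b + b * D a].

(** Independence of a family rather than of a set: a repeated entry already gives the relation X_i -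
    X_j. *)
Definition aindep (B : comAlgType K) n (f : 'I_n -> B) :=
  forall P : {mpoly K[n]}, aeval f P = 0 -> P = 0.

Lemma mderivXU n (i j : 'I_n) : ('X_i)^`M(j) = (i == j)%:R :> {mpoly K[n]}.
Proof.
rewrite mderivX mnm1E; case: eqP => [<-|_]; last by rewrite scale0r.
rewrite scale1r (_ : (U_(i) - U_(i))%MM = 0%MM) ?mpolyX0 //.
by apply/mnmP => k; rewrite mnmBE subnn mnm0E.
Qed.

Section Derivation.
Variables (B : comAlgType K) (D : B -> B).
Hypothesis D_der : derivation D.

Lemma derivationC c : D c%:A = 0.
Proof.
have [_ DZ DM] := D_der; suff D1 : D 1 = 0 by rewrite DZ D1 scaler0.
by apply: (@addrI _ (D 1)); rewrite addr0 -[RHS](congr1 D (mul1r 1)) DM !mul1r.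
Qed.

Lemma derivation_aeval n (f : 'I_n -> B) P :
  D (aeval f P) = \sum_i aeval f P^`M(i) * D (f i).
Proof.
have [DD _ DM] := D_der.
elim/mpoly_ring_ind: P => [c|i|p q IHp IHq|p q IHp IHq].
- rewrite aevalC derivationC big1 // => i _.
  by rewrite mderivC aeval0 mul0r.
- rewrite aevalX (bigD1 i) //= big1 ?addr0 => [|j ji].
    by rewrite mderivXU eqxx aeval1 mul1r.
  by rewrite mderivXU eq_sym (negPf ji) aeval0 mul0r.
- rewrite aevalD DD IHp IHq -big_split; apply: eq_bigr => i _ /=.
  by rewrite mderivD aevalD mulrDl.
- rewrite aevalM DM IHp IHq !big_distrr -big_split; apply: eq_bigr => i _ /=.
  by rewrite mderivM aevalD !aevalM; ring.
Qed.

End Derivation.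

Lemma mderiv_derivation n i :
  derivation (fun p : {mpoly K[n]} => p^`M(i)).
Proof.
split=> [p q|c p|p q]; rewrite ?mderivD ?mderivZ ?mderivM //.
by rewrite addrC [_ * q]mulrC.
Qed.

Lemma lrmorph_aeval (B C : comAlgType K) (phi : {lrmorphism B -> C})
    n (f : 'I_n -> B) P :
  phi (aeval f P) = aeval (phi \o f) P.
Proof.
elim/mpoly_ring_ind: P => [c|i|p q IHp IHq|p q IHp IHq].
- by rewrite !aevalC linearZ /= rmorph1.
- by rewrite !aevalX.
- by rewrite !aevalD raddfD /= IHp IHq.
- by rewrite !aevalM rmorphM /= IHp IHq.
Qed.

Lemma meval_aeval n k (f : 'I_n -> {mpoly K[k]}) P v :
  (aeval f P).@[v] = P.@[fun i => (f i).@[v]].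
Proof.
elim/mpoly_ring_ind: P => [c|i|p q IHp IHq|p q IHp IHq].
- by rewrite aevalC mevalZ meval1 mulr1 mevalC.
- by rewrite aevalX mevalXU.
- by rewrite aevalD !mevalD IHp IHq.
- by rewrite aevalM !mevalM IHp IHq.
Qed.

Lemma aeval_comp (B : comAlgType K) n k (f : 'I_n -> {mpoly K[k]})
    (g : 'I_k -> B) P :
  aeval g (aeval f P) = aeval (fun i => aeval g (f i)) P.
Proof.
elim/mpoly_ring_ind: P => [c|i|p q IHp IHq|p q IHp IHq].
- by rewrite !aevalC aevalZ aeval1.
- by rewrite !aevalX.
- by rewrite !aevalD IHp IHq.
- by rewrite !aevalM IHp IHq.
Qed.

Lemma aeval_id n (P : {mpoly K[n]}) : aeval (fun i => 'X_i) P = P.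
Proof.
elim/mpoly_ring_ind: P => [c|i|p q IHp IHq|p q IHp IHq].
- by rewrite aevalC -[LHS]/(c *: 1) -mul_mpolyC mulr1.
- by rewrite aevalX.
- by rewrite aevalD IHp IHq.
- by rewrite aevalM IHp IHq.
Qed.

Lemma eq_aeval (B : comAlgType K) n (f g : 'I_n -> B) P :
  f =1 g -> aeval f P = aeval g P.
Proof. by move=> /funext ->. Qed.

Lemma msize_mderiv n i (p : {mpoly K[n]}) :
  p != 0 -> (msize p^`M(i) < msize p)%N.
Proof.
move=> p0; have [q0|q0] := eqVneq p^`M(i) 0.
  by rewrite q0 msize0 -(mlead_deg p0).
rewrite -(mlead_deg q0); have := mlead_supp q0.
rewrite mcoeff_msupp mcoeff_mderiv => h.
have /msize_mdeg_lt : (mlead p^`M(i) + U_(i))%MM \in msupp p.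
  by rewrite mcoeff_msupp; apply: contraNneq h => ->; rewrite mul0rn.
by rewrite mdegD mdeg1 addn1.
Qed.

Hypothesis K_char0 : [pchar K] =i pred0.

Lemma mderiv_eq0 n i (p : {mpoly K[n]}) m :
  p^`M(i) = 0 -> m \in msupp p -> m i = 0%N.
Proof.
move=> dp; rewrite mcoeff_msupp; apply: contraNeq => mi.
have /eqP := congr1 (mcoeff (m - U_(i))%MM) dp.
rewrite mcoeff_mderiv mcoeff0 submK ?lep1mP // -mulr_natr mulf_eq0.
by rewrite (iffLR (pcharf0P K) K_char0) /= orbF.
Qed.

Lemma mderiv_eq0_const n (p : {mpoly K[n]}) :
  (forall i, p^`M(i) = 0) -> p = (p@_0)%:MP.
Proof.
move=> dp; apply/mpolyP => m; rewrite mcoeffC.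
have [->|m0] := eqVneq 0%MM m; first by rewrite mulr1.
rewrite mulr0; apply/eqP; rewrite mcoeff_eq0; apply: contra m0 => mp.
by apply/eqP/mnmP => i; rewrite mnm0E (mderiv_eq0 (dp i) mp).
Qed.

Lemma aeval_mderiv_eq0 (B : comAlgType K) n (f g : 'I_n -> B) i P :
  P^`M(i) = 0 -> (forall j, j != i -> f j = g j) -> aeval f P = aeval g P.
Proof.
move=> dP fg; rewrite /aeval /mmap; apply: eq_big_seq => m mP.
congr (_ * _); apply: eq_bigr => j _.
by have [->|/fg -> //] := eqVneq j i; rewrite (mderiv_eq0 dP mP) !expr0.
Qed.

(** Induction on the degree of a relation P. By the chain rule the row of the P_i(f), with P_i the
    partial derivatives, is killed by the Jacobian; the adjugate gives det J * P_i(f) = 0, so each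
    P_i is a relation of smaller degree and vanishes by induction. Then P is a constant, and this
    constant is 0. *)
Lemma jacobian_aindep (B : comAlgType K) n (D : 'I_n -> B -> B)
    (f : 'I_n -> B) :
  (forall a b : B, a * b = 0 -> a = 0 \/ b = 0) ->
  (forall i, derivation (D i)) ->
  \det (\matrix_(i, j) D j (f i)) <> 0 -> aindep f.
Proof.
move=> domB D_der J0 P; move: {2}(msize P).+1 (ltnSn (msize P)) => s.
elim: s P => // s IH P; rewrite ltnS => sP P0.
have [//|nzP] := eqVneq P 0.
suff dP i : P^`M(i) = 0.
  move: P0; rewrite (mderiv_eq0_const dP) aevalC.
  have [->|c0] := eqVneq P@_0 0; first by rewrite mpolyC0.
  by move/eqP; rewrite scaler_eq0 (negPf c0) oner_eq0.
apply: IH; first exact: leq_trans (msize_mderiv i nzP) _.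
set J := (\matrix_(i, j) _) in J0.
pose v : 'rV_n := \row_i aeval f P^`M(i).
have vJ : v *m J = 0.
  apply/rowP => j; rewrite !mxE.
  transitivity (D j (aeval f P)).
    rewrite (derivation_aeval (D_der j)).
    by apply: eq_bigr => k _; rewrite !mxE.
  by rewrite P0 -(scale0r 1) (derivationC (D_der j)) scale0r.
have /rowP/(_ i) : v *m (\det J)%:M = 0.
  by rewrite -mul_mx_adj mulmxA vJ mul0mx.
rewrite mul_mx_scalar !mxE => /domB[]// .
Qed.

End PolynomialRelations.

(** * Algebraic dependence by counting monomials *)

Section Counting.
Variable K : fieldType.

Lemma msize_prod_exp n k (g : 'I_k -> {mpoly K[n]}) d N (a : 'I_k -> nat) :
  (forall i, msize (g i) <= d)%N -> (forall i, a i < N)%N ->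
  (msize (\prod_i g i ^+ a i) <= (k * (N * d)).+1)%N.
Proof.
move=> gd aN.
have le_mul e1 e2 (p q : {mpoly K[n]}) :
    (msize p <= e1.+1 -> msize q <= e2.+1 -> msize (p * q) <= (e1 + e2).+1)%N.
  have [->|p0] := eqVneq p 0; first by rewrite mul0r msize0.
  have [->|q0] := eqVneq q 0; first by rewrite mulr0 msize0.
  by rewrite msizeM // -(mlead_deg p0) -(mlead_deg q0) addnS /=; lia.
have le_exp i e : (msize (g i ^+ e) <= (e * d).+1)%N.
  elim: e => [|e IH]; first by rewrite expr0 msize1.
  by rewrite exprS mulSn; apply: le_mul => //; apply: leqW.
have -> : (k * (N * d) = \sum_(i < k) N * d)%N by rewrite sum_nat_const card_ord.
elim/big_rec2: _ => [|i e p _ IH]; first by rewrite msize1.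
apply: le_mul => //; apply: leq_trans (le_exp i (a i)) _.
by rewrite ltnS leq_mul2r ltnW ?orbT.
Qed.

(* The monomials in the [g i] with exponents below [N] outnumber the          *)
(* monomials of the polynomial ring that can occur in them.                   *)
Lemma algebraic_dependence n k (g : 'I_k -> {mpoly K[n]}) :
  (n < k)%N -> exists2 P, P != 0 & aeval g P = 0.
Proof.
move=> nk; pose d := (\max_i msize (g i))%N.
(* All products of the g_i with exponents below N have degree below E. The choice of N gives E^n <=
   (N (kd + 1))^n < N^(n+1) <= N^k, so there are more products than monomials. *)
pose N := ((k * d).+1 ^ n).+1%N; pose E := (k * (N * d)).+1%N.
pose I := {ffun 'I_k -> 'I_N}; pose J := {ffun 'I_n -> 'I_E}.
have cardJI : (#|{: J}| < #|{: I}|)%N.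
  rewrite !card_ffun !card_ord; apply: leq_trans (_ : N ^ n.+1 <= _)%N; last first.
    by rewrite leq_exp2l // ltnS expn_gt0.
  have EN : (E <= N * (k * d).+1)%N by rewrite /E mulnS mulnCA -add1n leq_add2r.
  apply: (@leq_ltn_trans ((N * (k * d).+1) ^ n)); first by case: (n) => // n'; rewrite leq_exp2r.
  by rewrite expnMn expnS mulnC ltn_pmul2r ?expn_gt0.
pose mon (a : I) : 'X_{1..k} := [multinom (a i : nat) | i < k].
pose M := \matrix_(a < #|{: I}|, b < #|{: J}|)
  (aeval g 'X_[mon (enum_val a)])@_[multinom (enum_val b i : nat) | i < n].
have : ~~ row_free M by rewrite /row_free neq_ltn (leq_ltn_trans (rank_leq_col _)).
rewrite -kermx_eq0 => /rowV0Pn[u /sub_kermxP uM u0].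
pose P : {mpoly K[k]} := \sum_a u 0 a *: 'X_[mon (enum_val a)].
have monI : injective mon.
  move=> a b /mnmP ab; apply/ffunP => i; apply: val_inj.
  by have := ab i; rewrite !mnmE.
exists P.
  apply: contra u0 => /eqP P0; apply/eqP/rowP => a; rewrite mxE.
  rewrite -[RHS](mcoeff0 _ (mon (enum_val a))) -P0 raddf_sum (bigD1 a) //= big1.
    by rewrite addr0 mcoeffZ mcoeffX eqxx mulr1.
  move=> b ba; rewrite mcoeffZ mcoeffX (inj_eq monI) (inj_eq enum_val_inj).
  by rewrite (negPf ba) mulr0.
apply/mpolyP => m; rewrite mcoeff0 /P.
have -> : aeval g (\sum_a u 0 a *: 'X_[mon (enum_val a)]) =
    \sum_a u 0 a *: aeval g 'X_[mon (enum_val a)].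
  elim/big_rec2: _ => [|a p q _ <-]; first exact: aeval0.
  by rewrite aevalD aevalZ.
rewrite raddf_sum /=.
have [mE|/existsNP[i /negP]] := pselect (forall i, m i < E)%N.
  pose b : J := [ffun i => Ordinal (mE i)].
  move/rowP/(_ (enum_rank b)): uM; rewrite !mxE => uM.
  rewrite -[RHS]uM; apply: eq_bigr => a _; rewrite mcoeffZ !mxE enum_rankK.
  congr (_ * _@__); apply/mnmP => i.
  by rewrite mnmE ffunE.
rewrite -leqNgt => Ei.
apply: big1 => a _; rewrite mcoeffZ; apply/eqP; rewrite mulf_eq0 mcoeff_eq0.
apply/orP; right; apply: msize_mdeg_ge.
rewrite /aeval mmapX; apply: leq_trans (_ : E <= _)%N; last first.
  by apply: leq_trans Ei _; rewrite mdegE (bigD1 i) //= leq_addr.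
apply: msize_prod_exp => j; last by rewrite mnmE.
exact: (leq_bigmax j).
Qed.

End Counting.

(** * Polynomials as univariate polynomials in the last variable *)

Section IteratedPolynomials.
Variable K : fieldType.

HB.instance Definition _ (B : comAlgType K) n (f : 'I_n -> B) :=
  GRing.isZmodMorphism.Build {mpoly K[n]} B (aeval f) (aevalB f).
HB.instance Definition _ (B : comAlgType K) n (f : 'I_n -> B) :=
  GRing.isMonoidMorphism.Build {mpoly K[n]} B (aeval f)
    (aeval1 f, aevalM f).

Lemma muniX_max n : muni 'X_ord_max = 'X :> {poly {mpoly K[n]}}.
Proof.
rewrite muniE msuppX big_seq1 mcoeffX eqxx scale1r mnm1E eqxx expr1.
rewrite (_ : [multinom _ | _ < _] = 0%MM) ?mpolyX0 ?scale1r //.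
apply/mnmP => i; rewrite mnmE mnm0E mnm1E -val_eqE /=.
by rewrite gtn_eqF.
Qed.

Lemma muniX_widen n (i : 'I_n) :
  muni 'X_(widen_ord (leqnSn n) i) = ('X_i)%:P :> {poly {mpoly K[n]}}.
Proof.
rewrite muniE msuppX big_seq1 mcoeffX eqxx scale1r mnm1E -val_eqE /=.
rewrite ltn_eqF // expr0 -mul_polyC mulr1; congr ('X_[_])%:P.
by apply/mnmP => j; rewrite mnmE !mnm1E -!val_eqE.
Qed.

Lemma aeval_muni (B : comAlgType K) n (f : 'I_n.+1 -> B) P :
  aeval f P = (map_poly (aeval (fun i => f (widen_ord (leqnSn n) i))) (muni P)).[f ord_max].
Proof.
elim/mpoly_ring_ind: P => [c|i|p q IHp IHq|p q IHp IHq].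
- by rewrite muniC map_polyC hornerC /= !aevalC.
- rewrite aevalX; case: (unliftP ord_max i) => [j|] ->.
    have -> : lift ord_max j = widen_ord (leqnSn n) j.
      by apply: val_inj; rewrite /= /bump leqNgt ltn_ord.
    by rewrite muniX_widen map_polyC hornerC /= aevalX.
  by rewrite muniX_max map_polyX hornerX.
- by rewrite aevalD muniD rmorphD hornerD IHp IHq.
- by rewrite aevalM muniM rmorphM hornerM IHp IHq.
Qed.

Lemma muni_eq0 n (P : {mpoly K[n.+1]}) : (muni P == 0) = (P == 0).
Proof.
apply/eqP/eqP => [P0|->]; last exact: muni0.
by rewrite -[P]aeval_id aeval_muni P0 map_poly0 horner0.
Qed.

Lemma aeval_meval n (v : 'I_n -> K) P : aeval (v : 'I_n -> K^o) P = P.@[v].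
Proof.
elim/mpoly_ring_ind: P => [c|i|p q IHp IHq|p q IHp IHq].
- by rewrite aevalC mevalC; exact: mulr1.
- by rewrite aevalX mevalXU.
- by rewrite aevalD mevalD IHp IHq.
- by rewrite aevalM mevalM IHp IHq.
Qed.

End IteratedPolynomials.

(** * Points avoiding countably many hypersurfaces *)

Section UncountableField.
Variable K : closedFieldType.
Hypothesis K_uncountable : forall S : set K, countable S -> exists x, ~ S x.

(** Induction on the number of variables: a point v' avoiding the leading coefficients in the last
    variable leaves countably many nonzero univariate polynomials, whose roots form a countable
    set. *)
Lemma countable_nonroot n (q : nat -> {mpoly K[n]}) :
  (forall j, q j != 0) -> exists v : 'I_n -> K, forall j, (q j).@[v] != 0.
Proof.
elim: n q => [|n IH] q q0.
  exists (fun=> 0) => j; have := q0 j; apply: contra => /eqP qj0.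
  have -> : q j = ((q j)@_0)%:MP.
    apply/mpolyP => m; rewrite mcoeffC (_ : m = 0%MM) ?eqxx ?mulr1 //.
    by apply/mnmP => -[].
  move: qj0; rewrite [q j in LHS](_ : q j = ((q j)@_0)%:MP) ?mevalC => [->|] //.
  apply/mpolyP => m; rewrite mcoeffC (_ : m = 0%MM) ?eqxx ?mulr1 //.
  by apply/mnmP => -[].
have [j|v' v'P] := IH (fun j => lead_coef (muni (q j))).
  by rewrite lead_coef_eq0 muni_eq0.
pose r j : {poly K} := map_poly (meval v') (muni (q j)).
have r0 j : r j != 0 by rewrite -lead_coef_eq0 lead_coef_map_eq // v'P.
have [|x xP] := K_uncountable (S := \bigcup_(j in setT) [set x | root (r j) x]).
  apply: bigcup_countable => // j _; apply: finite_set_countable.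
  have [s ->] := closed_field_poly_normal (r j).
  apply: sub_finite_set (finite_seq s) => y /=.
  by rewrite rootZ ?lead_coef_eq0 // root_prod_XsubC.
exists (fun i => if unlift ord_max i is Some k then v' k else x) => j.
rewrite -aeval_meval aeval_muni unlift_none.
apply/negP => h; apply: xP; exists j => //=.
rewrite /root; move: h; congr (_.[_] == 0).
apply: eq_map_poly => p; apply: etrans (aeval_meval v' p); apply: eq_aeval => i.
have -> : widen_ord (leqnSn n) i = lift ord_max i.
  by apply: val_inj; rewrite /= /bump leqNgt ltn_ord.
by rewrite liftK.
Qed.

Lemma meval_inj n (p q : {mpoly K[n]}) :
  (forall v, p.@[v] = q.@[v]) -> p = q.
Proof.
move=> pq; apply/eqP; rewrite -subr_eq0; apply/negP => /negP nz.
have [v /(_ 0%N)] := countable_nonroot (fun=> nz).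
by rewrite mevalB pq subrr eqxx.
Qed.

End UncountableField.

(** * Separable relations and the Jacobian criterion *)

Section SeparableRelations.
Variable K : fieldType.
Hypothesis K_char0 : [pchar K] =i pred0.

Definition extend (T : Type) n (f : 'I_n -> T) (h : T) (i : 'I_n.+1) : T :=
  if unlift ord_max i is Some j then f j else h.

Lemma extend_widen (T : Type) n (f : 'I_n -> T) h i :
  extend f h (widen_ord (leqnSn n) i) = f i.
Proof.
rewrite /extend (_ : widen_ord _ i = lift ord_max i) ?liftK //.
by apply: val_inj; rewrite /= /bump leqNgt ltn_ord.
Qed.

Lemma extend_max (T : Type) n (f : 'I_n -> T) h : extend f h ord_max = h.
Proof. by rewrite /extend unlift_none. Qed.

Lemma comp_extend (T U : Type) (phi : T -> U) n (f : 'I_n -> T) h :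
  phi \o extend f h = extend (phi \o f) (phi h).
Proof. by apply: funext => i; rewrite /extend /=; case: unlift. Qed.

(** Starting from any relation Q, replace Q by its derivative in the last variable as long as that
    derivative is a nonzero relation; the degree drops. If the derivative is the zero polynomial, Q
    does not involve the last variable and would be a relation among the f alone. *)
Lemma separable_relation n (f : 'I_n -> {mpoly K[n]}) h :
  aindep f -> exists Q : {mpoly K[n.+1]},
    aeval (extend f h) Q = 0 /\ aeval (extend f h) Q^`M(ord_max) != 0.
Proof.
move=> f_indep.
have [Q Q0 fQ] := algebraic_dependence (extend f h) (leqnn n.+1).
move: {2}(msize Q).+1 (ltnSn (msize Q)) => s.
elim: s Q Q0 fQ => // s IH Q Q0 fQ; rewrite ltnS => sQ.
have [dfQ|] := eqVneq (aeval (extend f h) Q^`M(ord_max)) 0; last by exists Q.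
have [dQ|dQ0] := eqVneq Q^`M(ord_max) 0; last first.
  by apply: (IH _ dQ0 dfQ); apply: leq_trans (msize_mderiv _ Q0) sQ.
have off_max (B : comAlgType K) (u : 'I_n -> B) v w :
    aeval (extend u v) Q = aeval (extend u w) Q.
  apply: (aeval_mderiv_eq0 K_char0 dQ) => j; case: (unliftP ord_max j) => [k|] ->.
    by rewrite /extend liftK.
  by rewrite eqxx.
case/eqP: Q0; pose X i : {mpoly K[n.+1]} := 'X_(widen_ord (leqnSn n) i).
rewrite -[Q]aeval_id.
have -> : (fun i => 'X_i) = extend X 'X_ord_max.
  apply: funext => i; rewrite /extend /X; case: unliftP => [j|] -> //.
  by congr 'X__; apply: val_inj; rewrite /= /bump leqNgt ltn_ord.
rewrite (off_max _ _ _ 0).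
pose X0 : 'I_n.+1 -> {mpoly K[n]} := extend (fun i => 'X_i) 0.
have -> : extend X 0 = fun i => aeval X (X0 i).
  apply: funext => i; rewrite /X0 /extend.
  by case: unlift => [j|]; rewrite ?aevalX ?aeval0.
rewrite -aeval_comp [aeval X0 Q]f_indep ?aeval0 // aeval_comp -[RHS]fQ.
rewrite (off_max _ _ h 0); apply: eq_aeval => i; rewrite /X0 /extend.
by case: unlift => [j|]; rewrite ?aevalX ?aeval0.
Qed.

(** Differentiating separable relations Q_j(f, X_j) = 0 with respect to X_l gives G J = -
    diag(tau_j), where the separants tau_j are nonzero. *)
Lemma jacobian_neq0 n (f : 'I_n -> {mpoly K[n]}) :
  aindep f -> \det (\matrix_(i, j) (f i)^`M(j)) != 0.
Proof.
move=> f_indep; set J := \matrix_(i, j) _.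
have [Q QP] := fin_all_exists (fun j => separable_relation 'X_j f_indep).
pose tau j := aeval (extend f 'X_j) (Q j)^`M(ord_max).
pose G := \matrix_(j, i)
  aeval (extend f 'X_j) (Q j)^`M(widen_ord (leqnSn n) i).
have GJ : G *m J = diag_mx (\row_j - tau j).
  apply/matrixP => j l; rewrite !mxE; apply/eqP; rewrite -subr_eq0.
  rewrite [X in X == _](_ : _ = (aeval (extend f 'X_j) (Q j))^`M(l)).
    by rewrite (QP j).1 mderiv0.
  rewrite (derivation_aeval (mderiv_derivation K l)) big_ord_recr /=.
  rewrite extend_max mderivXU; congr (_ + _).
    by apply: eq_bigr => i _; rewrite !mxE extend_widen.
  by case: eqP => _; rewrite ?mulr1n ?mulr0n ?mulr1 ?mulr0 ?oppr0 ?opprK.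
have : \det (G *m J) != 0.
  rewrite GJ det_diag; apply/prodf_neq0 => j _.
  by rewrite mxE oppr_eq0 (QP j).2.
by rewrite det_mulmx mulf_eq0 negb_or => /andP[].
Qed.

End SeparableRelations.

(** * Dimension and cotangent spaces *)

Section KrullDimension.
Variables (K : closedFieldType) (A : comAlgType K).

Lemma ideal_mul (m : {pred A}) a u : idealr_closed m -> u \in m -> a * u \in m.
Proof. by case=> m0 _ mP um; rewrite -[_ * _]addr0 mP. Qed.

Lemma ideal_add (m : {pred A}) u v :
  idealr_closed m -> u \in m -> v \in m -> u + v \in m.
Proof. by case=> _ _ mP um vm; rewrite -[u]mul1r mP. Qed.

Lemma ideal_opp (m : {pred A}) u : idealr_closed m -> u \in m -> - u \in m.
Proof. by move=> mi um; rewrite -mulN1r ideal_mul. Qed.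

Lemma ideal_addr (m : {pred A}) u v :
  idealr_closed m -> u \in m -> (u + v \in m) = (v \in m).
Proof.
move=> mi um; apply/idP/idP => [uvm|]; last exact: ideal_add.
by rewrite -[v](addKr u) ideal_add // ideal_opp.
Qed.

Lemma ideal_scale (m : {pred A}) c u :
  idealr_closed m -> u \in m -> c *: u \in m.
Proof. by move=> mi um; rewrite -[u]mul1r scalerAl ideal_mul. Qed.

Lemma ideal_const (m : {pred A}) (c : K) :
  idealr_closed m -> (c%:A \in m) = (c == 0).
Proof.
move=> mi; apply/idP/eqP => [cm|->]; last by rewrite scale0r; case: mi.
apply/eqP; apply: contraLR (cm) => c0; case: (mi) => _ + _.
apply: contra => /(ideal_scale c^-1 mi).
by rewrite scalerA mulVf // scale1r.
Qed.

(** Descending the chain, each step adds an element f of P_(i+1) outside P_i to a family independent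
    modulo P_(i+1), and the result is independent modulo P_i: the constant term in f of a relation
    lies in P_(i+1), hence is zero, and then f cancels because P_i is prime. *)
Lemma prime_chain_leq n m (P : nat -> {pred A}) :
  (forall k (g : 'I_k -> A), (n < k)%N -> ~ aindep g) ->
  prime_chain m P -> (m <= n)%N.
Proof.
move=> dep [idP incP]; rewrite leqNgt; apply/negP => nm.
suff [x xP] : exists x : 'I_m -> A, forall Q, aeval x Q \in P 0%N -> Q = 0.
  apply: (dep _ x nm) => Q Q0; apply: xP; rewrite Q0.
  by case: (idP 0%N isT) => -[].
suff /(_ m (leqnn m)) : forall j, (j <= m)%N -> exists x : 'I_j -> A,
    forall Q, aeval x Q \in P (m - j)%N -> Q = 0 by rewrite subnn.
elim=> [_|j IH jm].
  exists (fun=> 0) => Q; have [iP _] := idP (m - 0)%N (leq_subr _ _).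
  rewrite (_ : Q = (Q@_0)%:MP).
    by rewrite aevalC ideal_const // => /eqP ->; rewrite mpolyC0.
  apply/mpolyP => k; rewrite mcoeffC (_ : k = 0%MM) ?eqxx ?mulr1 //.
  by apply/mnmP => -[].
have [x xP] := IH (ltnW jm).
set i := (m - j.+1)%N; have im : (i < m)%N by rewrite /i; lia.
have ij : i.+1 = (m - j)%N by rewrite /i; lia.
have [iPi pPi] := idP i (ltnW im); have [iPj _] := idP i.+1 im.
have [sub [f fj fi]] := incP i im.
exists (extend x f) => Q; rewrite aeval_muni extend_max => Qi.
apply/eqP; rewrite -muni_eq0; apply/eqP; move: (muni Q) Qi => {Q}.
have -> : (fun k => extend x f (widen_ord (leqnSn j) k)) = x.
  by apply: funext => k; rewrite extend_widen.
apply: poly_ind => // q c IHq.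
rewrite rmorphD rmorphM /= map_polyX map_polyC !hornerE /= => qi.
have c0 : c = 0.
  apply: xP; rewrite -ij; move/sub: qi.
  by rewrite ideal_addr // ideal_mul.
move: qi; rewrite c0 aeval0 addr0 polyC0 addr0 => /pPi.
by rewrite (negPf fi) orbF => /IHq ->; rewrite mul0r.
Qed.

Hypothesis K_char0 : [pchar K] =i pred0.
Hypothesis K_uncountable : forall S : set K, countable S -> exists x, ~ S x.

(** The primes are the ideals [I s] of elements vanishing on the s-dimensional coordinate plane V_s
    through y0. They grow strictly as s decreases: on V_(s-1) the s functions g_0, ..., g_(s-1)
    depend on s - 1 variables and satisfy a relation, while on V_s their Jacobian at y0 is the
    identity and they are independent. *)
Lemma prime_chain_exists n (phi : {lrmorphism A -> {mpoly K[n]}})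
    (f : 'I_n -> A) :
  aindep (phi \o f) -> exists P : nat -> {pred A}, prime_chain n P.
Proof.
move=> f_indep; have := jacobian_neq0 K_char0 f_indep.
set J := \matrix_(i, j) _ => J0.
have [y0 /(_ 0%N) y0P] := countable_nonroot K_uncountable (fun=> J0).
pose J0y := map_mx (meval y0) J.
have J0yu : J0y \in unitmx by rewrite unitmxE det_map_mx unitfE.
(* Linear recombination that makes the Jacobian at y0 the identity, so that all its leading
   principal minors are 1. *)
pose g i := \sum_k invmx J0y i k *: f k.
have dg i j : ((phi (g i))^`M(j)).@[y0] = (i == j)%:R.
  have : (invmx J0y *m J0y) i j = (i == j)%:R by rewrite mulVmx // mxE.
  rewrite mxE => <-.
  have -> : phi (g i) = \sum_k invmx J0y i k *: phi (f k).
    by rewrite raddf_sum /=; apply: eq_bigr => k _ /=; rewrite linearZ.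
  rewrite (big_morph (mderiv j) (mderivD j) (mderiv0 _ j)).
  rewrite (big_morph (meval y0) (mevalD y0) (meval0 y0)).
  by apply: eq_bigr => k _; rewrite !mxE mderivZ mevalZ.
(* Parametrisation of V_s: the first s coordinates are free, the others keep their values at y0. *)
pose rho s (l : 'I_n) : {mpoly K[s]} :=
  if insub (l : nat) is Some z then 'X_z else (y0 l)%:MP.
pose onV s (y : 'I_n -> K) := forall l : 'I_n, (s <= l)%N -> y l = y0 l.
pose I s : {pred A} := fun a => `[< forall y, onV s y -> (phi a).@[y] = 0 >].
have IP s a : (s <= n)%N -> reflect (aeval (rho s) (phi a) = 0) (a \in I s).
  move=> sn; rewrite unfold_in /=; apply: (iffP (asboolP _)) => [aV|a0 y yV].
    apply: (meval_inj K_uncountable) => z; rewrite meval0 meval_aeval.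
    apply: aV => l sl; rewrite /rho insubF ?mevalC //.
    by rewrite ltnNge sl.
  have -> : (phi a).@[y] =
      (aeval (rho s) (phi a)).@[fun z => y (widen_ord sn z)].
    rewrite meval_aeval; apply: meval_eq => l; rewrite /rho.
    case: insubP => [z _ zl|]; last by rewrite -leqNgt mevalC => /yV.
    by rewrite mevalXU; congr y; apply: val_inj.
  by rewrite a0 meval0.
exists (fun i => I (n - i)%N); split => [i _|i ni].
  set s := (n - i)%N; have sn : (s <= n)%N by exact: leq_subr.
  split; first split.
  - by apply/(IP _ _ sn); rewrite raddf0 aeval0.
  - by apply/(IP _ _ sn); rewrite rmorph1 aeval1; apply/eqP/oner_neq0.
  - move=> a u v /(IP _ _ sn) u0 /(IP _ _ sn) v0; apply/(IP _ _ sn).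
    by rewrite rmorphD rmorphM aevalD aevalM u0 v0 mulr0 addr0.
  - move=> u v /(IP _ _ sn); rewrite rmorphM aevalM => /eqP.
    by rewrite mulf_eq0 => /orP[] /eqP/(IP _ _ sn) ->; rewrite ?orbT.
rewrite subnS; set s := (n - i)%N; have sn : (s <= n)%N by exact: leq_subr.
have s0 : (0 < s)%N by rewrite subn_gt0.
split => [a /asboolP aV|].
  by apply/asboolP => y yV; apply: aV => l sl; apply: yV; lia.
pose h z := g (widen_ord sn z).
have [P P0 hP] := algebraic_dependence
  (fun z => aeval (rho s.-1) (phi (h z))) (ltac:(lia) : (s.-1 < s)%N).
exists (aeval h P).
  apply/IP; first lia.
  by rewrite lrmorph_aeval aeval_comp.
apply: contra P0 => /(IP _ _ sn); rewrite lrmorph_aeval aeval_comp => h0.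
apply/eqP; move: P h0 {hP}.
apply: (@jacobian_aindep _ K_char0 _ _ (fun j p => p^`M(j))) => [a b /eqP||].
- by rewrite mulf_eq0 => /orP[]/eqP; [left|right].
- by move=> j; exact: mderiv_derivation.
move/(congr1 (meval (fun z => y0 (widen_ord sn z)))).
rewrite meval0 -det_map_mx => /eqP; apply/negP.
rewrite [X in \det X](_ : _ = 1%:M) ?det1 ?oner_neq0 //.
apply/matrixP => z j; rewrite !mxE /h -val_eqE.
rewrite (derivation_aeval (mderiv_derivation K j)).
have rhoE l : (rho s l).@[fun z => y0 (widen_ord sn z)] = y0 l.
  rewrite /rho; case: insubP => [w _ wl|_]; last by rewrite mevalC.
  by rewrite mevalXU; congr y0; apply: val_inj.
rewrite (bigD1 (widen_ord sn j)) //= big1 => [|l lj]; last first.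
  rewrite /rho; case: insubP => [w _ wl|_]; last by rewrite mderivC mulr0.
  rewrite mderivXU (_ : w == j = false) ?mulr0 //.
  by apply: contraNF lj => /eqP <-; apply/eqP/val_inj.
rewrite addr0 mevalM meval_aeval (meval_eq _ rhoE) dg.
rewrite /rho; case: insubP => [w _ wj|]; last by rewrite /= ltn_ord.
by rewrite (val_inj wj : w = j) mderivXU eqxx meval1 mulr1.
Qed.

End KrullDimension.

(** * Cotangent spaces at maximal ideals *)

Section CotangentSpace.
Variables (K : closedFieldType) (A : comAlgType K).
Implicit Types (m : {pred A}) (p : max_spec A).

Lemma sum_ideal m (I : Type) (r : seq I) (F : I -> A) :
  idealr_closed m -> (forall i, F i \in m) -> \sum_(i <- r) F i \in m.
Proof.
move=> mi Fm; elim/big_ind: _ => //; first by case: mi.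
by move=> u v; exact: ideal_add.
Qed.

Lemma ideal_square0 m : ideal_square m 0.
Proof.
exists 0%N, (fun=> 0), (fun=> 0); rewrite big_ord0.
by split=> // -[].
Qed.

Lemma ideal_squareD m u v :
  ideal_square m u -> ideal_square m v -> ideal_square m (u + v).
Proof.
move=> [k [a [b [am bm ->]]]] [l [c [d [cm dm ->]]]].
pose sel (x : 'I_k -> A) (y : 'I_l -> A) i :=
  match fintype.split i with inl j => x j | inr j => y j end.
exists (k + l)%N, (sel a c), (sel b d); split=> [i|i|].
- by rewrite /sel; case: fintype.split.
- by rewrite /sel; case: fintype.split.
rewrite big_split_ord /=; congr (_ + _); apply: eq_bigr => i _; rewrite /sel.
  by rewrite (unsplitK (inl i)).
by rewrite (unsplitK (inr i)).
Qed.

Lemma ideal_squareM m a b : a \in m -> b \in m -> ideal_square m (a * b).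
Proof. by move=> am bm; exists 1%N, (fun=> a), (fun=> b); rewrite big_ord1. Qed.

Lemma ideal_squareMl m a u :
  idealr_closed m -> ideal_square m u -> ideal_square m (a * u).
Proof.
move=> mi [k [b [c [bm cm ->]]]]; exists k, (fun i => a * b i), c; split=> //.
  by move=> i; apply: ideal_mul.
by rewrite big_distrr /=; apply: eq_bigr => i _; rewrite mulrA.
Qed.

Lemma ideal_squareZ m c u :
  idealr_closed m -> ideal_square m u -> ideal_square m (c *: u).
Proof. by move=> mi um; rewrite -[u]mul1r scalerAl; apply: ideal_squareMl. Qed.

Lemma ideal_squareN m u :
  idealr_closed m -> ideal_square m u -> ideal_square m (- u).
Proof. by move=> mi um; rewrite -mulN1r; apply: ideal_squareMl. Qed.

Lemma ideal_square_sum m (I : Type) (r : seq I) (F : I -> A) :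
  (forall i, ideal_square m (F i)) -> ideal_square m (\sum_(i <- r) F i).
Proof.
move=> Fm; elim/big_ind: _ => //; first exact: ideal_square0.
by move=> u v; apply: ideal_squareD.
Qed.

Lemma ideal_square_derivation m (D : A -> A) u :
  idealr_closed m -> derivation D -> ideal_square m u -> D u \in m.
Proof.
move=> mi [DD DZ DM] [k [a [b [am bm ->]]]].
elim/big_ind: _ => [|u' v um vm|i _].
- by rewrite -(scale0r 0) DZ scale0r; case: mi.
- by rewrite DD ideal_add.
by rewrite DM ideal_add // mulrC ideal_mul.
Qed.

(** Otherwise m + (a) would be a proper ideal strictly larger than m. *)
Lemma maximal_inverse m a :
  maximal_ideal m -> a \notin m -> exists b, b * a - 1 \in m.
Proof.
move=> [mi m_max] am; apply: contrapT => nb.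
pose J : {pred A} := fun x => `[< exists b, x - b * a \in m >].
have mJ : {subset m <= J}.
  by move=> x xm; apply/asboolP; exists 0; rewrite mul0r subr0.
have aJ : a \in J.
  by apply/asboolP; exists 1; rewrite mul1r subrr; case: mi.
have Ji : idealr_closed J.
  split; first by apply: mJ; case: mi.
    apply/asboolP => -[b bm]; apply: nb; exists b.
    by rewrite -opprB ideal_opp.
  move=> c u v /asboolP[b bm] /asboolP[d dm]; apply/asboolP.
  exists (c * b + d); rewrite (_ : _ - _ = c * (u - b * a) + (v - d * a)).
    by rewrite ideal_add // ideal_mul.
  by ring.
by move: am; rewrite (m_max J Ji mJ a aJ).
Qed.

Lemma maximal_prime m : maximal_ideal m -> prime_idealr_closed m.
Proof.
move=> m_max u v uvm; have [mi _] := m_max.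
case: (boolP (u \in m)) => //= um.
have [b bm] := maximal_inverse m_max um.
rewrite (_ : v = b * (u * v) - v * (b * u - 1)); last by ring.
by rewrite ideal_add ?ideal_opp // ideal_mul.
Qed.

(* Some [P a] with [P <> 0] kills a nonzero class of the finite-dimensional   *)
(* space m / m^2, so that it lies in m; the roots of [P] are in K.            *)
Lemma residue_field m d (g : 'I_d -> A) a :
  maximal_ideal m -> (0 < d)%N -> cotangent_basis m g ->
  exists v : K, a - v%:A \in m.
Proof.
move=> m_max d0 [gm g_span g_free]; have [mi _] := m_max.
pose g0 := g (Ordinal d0).
have g0_sq : ~ ideal_square m g0.
  move=> g0_sq; have := g_free (fun i => (i == Ordinal d0)%:R).
  rewrite (bigD1 (Ordinal d0)) //= ?eqxx scale1r big1 => [|i /negPf ->].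
    by rewrite addr0 => /(_ g0_sq (Ordinal d0)) /eqP; rewrite eqxx oner_eq0.
  by rewrite scale0r.
have [c cP] := fin_all_exists (fun k : 'I_d.+1 =>
  g_span (a ^+ k * g0) (ideal_mul _ mi (gm _))).
pose C := \matrix_(k, i) c k i.
have : ~~ row_free C by rewrite /row_free neq_ltn ltnS rank_leq_col.
rewrite -kermx_eq0 => /rowV0Pn[u /sub_kermxP uC u0].
pose P := \poly_(k < d.+1) (u 0 (inord k)).
have P0 : P != 0.
  apply: contra u0 => /eqP P0; apply/eqP/rowP => k; rewrite mxE.
  by rewrite -[RHS](coef0 K k) -P0 coef_poly ltn_ord inord_val.
pose Pa := \sum_(k < d.+1) u 0 k *: a ^+ k.
have Pa_sq : ideal_square m (Pa * g0).
  have uCg : \sum_k u 0 k *: \sum_i c k i *: g i = 0.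
    under eq_bigr do rewrite scaler_sumr.
    rewrite exchange_big big1 //= => i _.
    under eq_bigr do rewrite scalerA.
    rewrite -scaler_suml; move/rowP/(_ i): uC; rewrite !mxE => uC.
    rewrite [X in X *: _](_ : _ = 0) ?scale0r // -[RHS]uC.
    by apply: eq_bigr => k _; rewrite mxE.
  have -> : Pa * g0 = \sum_k u 0 k *: (a ^+ k * g0 - \sum_i c k i *: g i).
    under [RHS]eq_bigr do rewrite scalerBr.
    rewrite sumrB uCg subr0 big_distrl.
    by apply: eq_bigr => k _; rewrite scalerAl.
  by apply: ideal_square_sum => k; apply: ideal_squareZ => //; apply: cP.
have Pam : Pa \in m.
  apply/negPn/negP => /(maximal_inverse m_max)[b bm]; apply: g0_sq.
  rewrite (_ : g0 = b * (Pa * g0) - (b * Pa - 1) * g0); last by ring.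
  apply: ideal_squareD; first exact: ideal_squareMl.
  by apply: ideal_squareN => //; apply: ideal_squareM => //; apply: gm.
have PaE : Pa = (map_poly (in_alg A) P).[a].
  rewrite -[P]/(\poly_(_ < _) _) /P poly_def rmorph_sum horner_sum.
  apply: eq_bigr => k _; rewrite inord_val -mul_polyC rmorphM /= map_polyC /=.
  by rewrite map_polyXn !hornerE -scalerAl mul1r.
move: Pam; rewrite PaE; have [s sP] := closed_field_poly_normal P.
rewrite sP -mul_polyC rmorphM /= map_polyC rmorph_prod /= hornerM hornerC.
move/(maximal_prime m_max); rewrite ideal_const // lead_coef_eq0 (negPf P0) /=.
elim: s {sP} => [|v s IH].
  by rewrite big_nil hornerC; case: mi => _ /negPf ->.
rewrite big_cons hornerM => /(maximal_prime m_max)/orP[]; last exact: IH.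
by rewrite rmorphB /= map_polyX map_polyC !hornerE /= => am; exists v.
Qed.

(** n independent classes in a space of dimension n: the matrix C expressing h through g modulo m^2
    has trivial left kernel, hence is invertible. *)
Lemma cotangent_basis_free m n (g h : 'I_n -> A) :
  idealr_closed m -> cotangent_basis m g -> (forall i, h i \in m) ->
  (forall c : 'I_n -> K,
    ideal_square m (\sum_i c i *: h i) -> forall i, c i = 0) ->
  cotangent_basis m h.
Proof.
move=> mi [gm g_span g_free] hm h_free; split=> // a am.
have [c cP] := fin_all_exists (fun i => g_span _ (hm i)).
pose C := \matrix_(i, j) c i j.
have combC (u : 'rV_n) : ideal_square m
    (\sum_i u 0 i *: h i - \sum_j (u *m C) 0 j *: g j).
  have -> : \sum_i u 0 i *: h i - \sum_j (u *m C) 0 j *: g j =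
      \sum_i u 0 i *: (h i - \sum_j c i j *: g j).
    rewrite [X in _ - X](_ : _ = \sum_i u 0 i *: \sum_j c i j *: g j).
      by rewrite -sumrB; apply: eq_bigr => i _; rewrite scalerBr.
    under eq_bigr => j _ do rewrite mxE scaler_suml.
    rewrite exchange_big; apply: eq_bigr => i _; rewrite scaler_sumr.
    by apply: eq_bigr => j _; rewrite mxE scalerA.
  by apply: ideal_square_sum => i; apply: ideal_squareZ => //; apply: cP.
have Cu : C \in unitmx.
  rewrite -row_free_unit -kermx_eq0; apply/rowV0P => u /sub_kermxP uC.
  apply/rowP => i; rewrite mxE; apply: h_free.
  have := combC u; rewrite uC [X in _ - X]big1 ?subr0 // => j _.
  by rewrite mxE scale0r.
have [e eP] := g_span a am.
pose u := \row_j e j *m invmx C.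
exists (fun i => u 0 i).
rewrite (_ : a - _ = (a - \sum_j e j *: g j) -
    (\sum_i u 0 i *: h i - \sum_j (u *m C) 0 j *: g j)).
  by apply: ideal_squareD => //; apply: ideal_squareN.
rewrite /u mulmxKV // opprB addrA; congr (_ - _).
rewrite [X in _ + X](_ : _ = \sum_j e j *: g j) ?subrK //.
by apply: eq_bigr => j _; rewrite mxE.
Qed.

Lemma taylor2 m n (P : {mpoly K[n]}) (a : 'I_n -> A) (v : 'I_n -> K) :
  idealr_closed m -> (forall i, a i - (v i)%:A \in m) ->
  ideal_square m
    (aeval a P - P.@[v]%:A - \sum_i P^`M(i).@[v] *: (a i - (v i)%:A)).
Proof.
move=> mi avm; pose lin P := \sum_i P^`M(i).@[v] *: (a i - (v i)%:A).
rewrite -/(lin P).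
have linm Q : lin Q \in m by apply: sum_ideal => // i; apply: ideal_scale.
elim/mpoly_ring_ind: P => [c|i|p q IHp IHq|p q IHp IHq].
- rewrite /lin big1 => [|i _]; last by rewrite mderivC meval0 scale0r.
  by rewrite aevalC mevalC subrr subr0; apply: ideal_square0.
- rewrite /lin (bigD1 i) //= big1 => [|j ji].
    by rewrite mderivXU eqxx meval1 scale1r aevalX mevalXU addr0 subrr;
      apply: ideal_square0.
  by rewrite mderivXU eq_sym (negPf ji) meval0 scale0r.
- rewrite (_ : _ - _ = (aeval a p - p.@[v]%:A - lin p) +
      (aeval a q - q.@[v]%:A - lin q)); first exact: ideal_squareD.
  have -> : lin (p + q) = lin p + lin q.
    rewrite /lin -big_split; apply: eq_bigr => i _ /=.
    by rewrite mderivD mevalD scalerDl.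
  by rewrite aevalD mevalD scalerDl; ring.
have -> : lin (p * q) = q.@[v]%:A * lin p + p.@[v]%:A * lin q.
  rewrite /lin !big_distrr -big_split; apply: eq_bigr => i _ /=.
  rewrite mderivM mevalD !mevalM scalerDl -!scalerAl !mul1r !scalerA.
  by rewrite [p^`M(i).@[v] * _]mulrC.
set s := (aeval a p - _ - _) in IHp; set t := (aeval a q - _ - _) in IHq.
(* Beyond its linear terms the product leaves the product of the two linear parts and multiples of
   the remainders s and t, all in m^2. *)
rewrite (_ : _ - _ = lin p * lin q + (aeval a q * s + (aeval a p - s) * t)).
  apply: ideal_squareD; first exact: ideal_squareM.
  by apply: ideal_squareD; apply: ideal_squareMl.
have -> : (p * q).@[v]%:A = p.@[v]%:A * q.@[v]%:A :> A.
  by rewrite mevalM -scalerAl mul1r scalerA.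
by rewrite aevalM /s /t; ring.
Qed.

End CotangentSpace.

Section AlgebraicIndependence.
Variables (K : closedFieldType) (A : comAlgType K).

Lemma aindep_inj n (f : 'I_n -> A) : aindep f -> injective f.
Proof.
move=> f_indep i j fij; apply: contrapT => /eqP ij.
have /(congr1 (mderiv i)) : ('X_i - 'X_j : {mpoly K[n]}) = 0.
  by apply: f_indep; rewrite aevalB !aevalX fij subrr.
move/eqP; rewrite mderivB !mderivXU eqxx (eq_sym j) (negPf ij) subr0 mderiv0.
by rewrite oner_eq0.
Qed.

Lemma aindep_sub n k (f : 'I_n -> A) (s : 'I_k -> 'I_n) :
  injective s -> aindep f -> aindep (f \o s).
Proof.
move=> s_inj f_indep P.
pose X i : {mpoly K[n]} := 'X_(s i).
have -> : f \o s = fun i => aeval f (X i).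
  by apply: funext => i; rewrite aevalX.
rewrite -aeval_comp => /f_indep.
(* Left inverse of the renaming of variables by s. *)
pose Y j : {mpoly K[k]} := if [pick i | s i == j] is Some i then 'X_i else 0.
move/(congr1 (aeval Y)); rewrite aeval0 aeval_comp => <-.
rewrite -[LHS]aeval_id; apply: eq_aeval => i; rewrite aevalX /Y.
by case: pickP => [j /eqP/s_inj -> //|/(_ i)]; rewrite eqxx.
Qed.

Lemma aindep_range n (f : 'I_n -> A) : aindep f -> alg_independent (range f).
Proof.
move=> f_indep k g g_inj g_range P.
have /fin_all_exists[s sP] i : exists j, f j = g i.
  by have [j _ <-] := g_range i; exists j.
have -> : g = f \o s by apply: funext => i; rewrite /= sP.
apply: aindep_sub => // i j /(congr1 f); rewrite !sP; exact: g_inj.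
Qed.

End AlgebraicIndependence.

(** * Local parameters from an embedding and derivations *)

Section GenericParameters.
Variables (K : closedFieldType) (A : comAlgType K) (n : nat).
Hypothesis K_char0 : [pchar K] =i pred0.
Hypothesis K_uncountable : forall S : set K, countable S -> exists x, ~ S x.
Hypothesis n_gt0 : (0 < n)%N.
Variable phi : {lrmorphism A -> {mpoly K[n]}}.
Hypothesis phi_inj : injective phi.
Variables (f : 'I_n -> A) (D : 'I_n -> A -> A).
Hypothesis D_der : forall j, derivation (D j).

Let jac := \det (\matrix_(i, j) D j (f i)).
Hypothesis jac_neq0 : jac <> 0.

Let phi_eq0 a : phi a = 0 -> a = 0.
Proof. by rewrite -(raddf0 phi); apply: phi_inj. Qed.

Lemma aindep_phi k (g : 'I_k -> A) : aindep g <-> aindep (phi \o g).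
Proof.
split=> g_indep P; first by rewrite -lrmorph_aeval => /phi_eq0/g_indep.
by move=> gP; apply: g_indep; rewrite -lrmorph_aeval gP raddf0.
Qed.

Lemma aindep_bound k (g : 'I_k -> A) : (n < k)%N -> ~ aindep g.
Proof.
move=> nk /aindep_phi g_indep.
have [P P0 /g_indep/eqP] := algebraic_dependence (phi \o g) nk.
exact/negP.
Qed.

Lemma aindep_f : aindep f.
Proof.
apply: (jacobian_aindep K_char0 _ D_der jac_neq0) => a b ab.
have /eqP : phi a * phi b = 0 by rewrite -rmorphM ab raddf0.
by rewrite mulf_eq0 => /orP[]/eqP/phi_eq0; [left|right].
Qed.

Lemma krull_dim_n : krull_dim A n.
Proof.
split; last by move=> m P; apply: prime_chain_leq aindep_bound.
exact: (prime_chain_exists K_char0 K_uncountable (iffLR (aindep_phi f) aindep_f)).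
Qed.

Lemma krull_dim_unique d : krull_dim A d -> d = n.
Proof.
have [[P Pn] max_n] := krull_dim_n; move=> [[Q Qd] max_d].
by apply/eqP; rewrite eqn_leq (max_n _ _ Qd) (max_d _ _ Pn).
Qed.

Lemma maximal_aindep_f : maximal_alg_independent (range f).
Proof.
split; first exact/aindep_range/aindep_f.
move=> S fS S_indep t St; apply: contrapT => ft.
apply: (@aindep_bound n.+1 (extend f t)) => // P; apply: S_indep.
  move=> i j; rewrite /extend; case: unliftP => [i' ->|->]; case: unliftP => [j' ->|->] //.
  - by move/(aindep_inj aindep_f) ->.
  - by move=> fit; case: ft; exists i'.
  - by move=> fjt; case: ft; exists j'.
by move=> i; rewrite /extend; case: unlift => [j|] //; apply: fS; exists j.
Qed.

(** Applying D_j to an element of m^2 puts sum_i c_i D_j(f_i) in m for every j. The adjugate turns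
    this into c_i * J in m; as m is prime and J is not in m, the constant c_i lies in m and is 0. *)
Lemma jac_free (m : {pred A}) (v : 'I_n -> K) (c : 'I_n -> K) :
  idealr_closed m -> prime_idealr_closed m -> jac \notin m ->
  ideal_square m (\sum_i c i *: (f i - (v i)%:A)) -> forall i, c i = 0.
Proof.
move=> mi m_prime jm c0 i; apply/eqP; rewrite -(ideal_const _ mi).
pose J := \matrix_(i, j) D j (f i).
have cJ j : \sum_i (c i)%:A * J i j \in m.
  have := ideal_square_derivation mi (D_der j) c0.
  congr (_ \in m); have [DD DZ DM] := D_der j.
  have D0 : D j 0 = 0 by rewrite -[X in D j X](scale0r 0) DZ scale0r.
  rewrite (big_morph (D j) DD D0); apply: eq_bigr => k _.
  rewrite DZ mxE -scalerAl mul1r; congr (_ *: _).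
  by rewrite DD -scaleNr (derivationC (D_der j)) addr0.
have : (c i)%:A * \det J \in m.
  rewrite [X in X \in m](_ : _ =
      \sum_j \adj J j i * \sum_k (c k)%:A * J k j).
    by apply: sum_ideal => // j; apply: ideal_mul.
  under [RHS]eq_bigr do rewrite big_distrr.
  rewrite exchange_big (bigD1 i) //= [X in _ + X]big1 ?addr0 => [|k ki].
    have /matrixP/(_ i i) := mul_mx_adj J; rewrite !mxE eqxx mulr1n => <-.
    by rewrite big_distrr; apply: eq_bigr => j _; rewrite /=; ring.
  have /matrixP/(_ k i) := mul_mx_adj J; rewrite !mxE (negPf ki) mulr0n => kJ.
  rewrite -[RHS](mulr0 (c k)%:A) -[X in _ = _ * X]kJ big_distrr.
  by apply: eq_bigr => j _; rewrite /=; ring.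
by move/m_prime; rewrite (negPf jm) orbF.
Qed.

Lemma range_local_parameters (p : max_spec A) :
  jac \notin (p : {pred A}) -> smooth_locus p -> local_parameters p (range f).
Proof.
move=> jp [d [g [/krull_dim_unique dn pg]]]; subst d.
have p_max := ideal_ofP p; have [pi _] := p_max.
have [v vP] := fin_all_exists (fun i => residue_field (f i) p_max n_gt0 pg).
exists n, f, v; split=> //.
- exact: krull_dim_n.
- exact/aindep_inj/aindep_f.
- apply: (cotangent_basis_free pi pg) => // c.
  exact: jac_free pi (maximal_prime p_max) jp.
Qed.

Section Point.
Variable y : 'I_n -> K.

Definition point_ideal : A -> bool := fun a => (phi a).@[y] == 0.

Lemma point_idealr : idealr_closed (point_ideal : {pred A}).
Proof.
split; rewrite ?unfold_in /point_ideal ?raddf0 ?meval0 ?rmorph1 ?meval1 //.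
  exact: oner_neq0.
move=> a u v; rewrite !unfold_in /point_ideal => /eqP u0 /eqP v0.
by rewrite rmorphD rmorphM mevalD mevalM u0 v0 mulr0 addr0.
Qed.

Lemma phi_const (c : K) : phi c%:A = c%:MP.
Proof. by rewrite linearZ /= rmorph1 -mul_mpolyC mulr1. Qed.

Lemma point_value a : a - ((phi a).@[y])%:A \in (point_ideal : {pred A}).
Proof.
by rewrite unfold_in /point_ideal rmorphB /= phi_const mevalB mevalC subrr.
Qed.

Lemma point_maximal : maximal_ideal (point_ideal : {pred A}).
Proof.
split; first exact: point_idealr.
move=> J Ji pJ u uJ; rewrite unfold_in /point_ideal.
rewrite -(ideal_const _ Ji).
rewrite (_ : _%:A = u - (u - ((phi u).@[y])%:A)); last by ring.
by apply: ideal_add => //; apply: ideal_opp => //; apply/pJ/point_value.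
Qed.

End Point.

(** A has countable dimension: h picks one element for each leading monomial occurring in phi(A),
    and 0 at the remaining indices. Subtracting a multiple of it lowers the leading monomial, which
    is a well-founded process. *)
Lemma countable_generators : exists h : nat -> A, forall T : A -> Prop,
  T 0 -> (forall c a b, T a -> T b -> T (c *: a + b)) -> (forall j, T (h j)) ->
  forall a, T a.
Proof.
pose lead m a := phi a != 0 /\ mlead (phi a) = m.
have /choice[h hP] (j : nat) : exists a, forall m b,
    unpickle j = Some m -> lead m b -> lead m a.
  case: (unpickle j) => [m|]; last by exists 0.
  have [[a am]|none] := pselect (exists a, lead m a).
    by exists a => _ b [<-].
  by exists 0 => _ b [<-] bm; case: none; exists b.
exists h => T T0 Tlin Th a; move: {2}(phi a) (erefl (phi a)) => q.
elim/mleadrect: q a => q IH a aq.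
have [a0|a0] := eqVneq (phi a) 0; first by rewrite (phi_eq0 a0).
pose b := h (pickle (mlead (phi a))).
have [b0 bm] : lead (mlead (phi a)) b.
  exact: (hP _ _ a (pickleK _) (conj a0 erefl)).
pose c := mleadc (phi a) / mleadc (phi b).
rewrite -[a](subrK (c *: b)) addrC; apply: Tlin; first exact: Th.
have [->//|ab0] := eqVneq (a - c *: b) 0.
have phi_ab : phi (a - c *: b) = phi a - c *: phi b.
  by rewrite raddfB /= linearZ.
have phi_ab0 : phi (a - c *: b) != 0 by apply: contra ab0 => /eqP/phi_eq0 ->.
apply: IH erefl; rewrite -aq lt_neqAle; apply/andP; split.
  apply: contraNneq (phi_ab0) => ab_lead; rewrite -mleadc_eq0 ab_lead.
  rewrite phi_ab mcoeffB mcoeffZ -{2}bm /c mulfVK ?subrr //.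
  by rewrite mleadc_eq0.
rewrite phi_ab; apply: le_trans (mleadB_le _ _) _.
by rewrite leUx lexx -bm mleadZ_le.
Qed.

(** Choose y off the zeros of J and of the separants tau_j of the relations Q_j(f, h_j) = 0.
    Expanding Q_j to first order at y, the coefficient tau_j(y) of h_j - h_j(y) is invertible, so
    this difference is a combination of the f_i - f_i(y) modulo m^2; by linearity this extends to
    all of A. Uncountability of K allows countably many conditions, so finite generation of A is
    never invoked. *)
Lemma smooth_point : exists2 p : max_spec A, jac \notin (p : {pred A})
  & smooth_locus p.
Proof.
have phif : aindep (phi \o f) by apply/aindep_phi/aindep_f.
have [h h_gen] := countable_generators.
have /choice[Q QP] j := separable_relation K_char0 (phi (h j)) phif.
pose tau j := aeval (extend (phi \o f) (phi (h j))) (Q j)^`M(ord_max).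
have [j|y yP] := countable_nonroot K_uncountable
    (q := fun j => tau j * phi jac).
  rewrite mulf_neq0 ?(QP j).2 //.
  by apply/eqP => /phi_eq0.
have [taujac_y jac_y] : (forall j, (tau j).@[y] != 0) /\ (phi jac).@[y] != 0.
  by split=> [j|]; [have := yP j|have := yP 0%N];
    rewrite mevalM mulf_eq0 negb_or => /andP[].
pose p := MaxSpec (point_maximal y); have [pi _] := ideal_ofP p.
exists p => //; exists n, (fun i => f i - ((phi (f i)).@[y])%:A).
split; first exact: krull_dim_n.
split=> [i||c]; first exact: point_value; last first.
  apply: jac_free pi (maximal_prime (ideal_ofP p)) _.
  exact: jac_y.
pose F i := f i - ((phi (f i)).@[y])%:A.
pose spanned a := exists c : 'I_n -> K,
  ideal_square p (a - ((phi a).@[y])%:A - \sum_i c i *: F i).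
suff spA a : spanned a.
  move=> a ap; have [c cP] := spA a; exists c; move: cP.
  by rewrite (eqP (ap : (phi a).@[y] == 0)) scale0r subr0.
apply: h_gen.
- exists (fun=> 0); rewrite raddf0 meval0 scale0r subr0 big1 ?subr0.
    exact: ideal_square0.
  by move=> i _; rewrite scale0r.
- move=> c u w [d dP] [e eP]; exists (fun i => c * d i + e i).
  rewrite (_ : _ - _ = c *: (u - ((phi u).@[y])%:A - \sum_i d i *: F i) +
      (w - ((phi w).@[y])%:A - \sum_i e i *: F i)).
    by apply: ideal_squareD => //; apply: ideal_squareZ.
  have -> : phi (c *: u + w) = c *: phi u + phi w by rewrite raddfD /= linearZ.
  rewrite mevalD mevalZ scalerDl -scalerA.
  under eq_bigr do rewrite scalerDl -scalerA.
  rewrite big_split -scaler_sumr /= !scalerBr.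
  have E (a1 a2 b1 b2 c1 c2 : A) :
    a1 + a2 - (b1 + b2) - (c1 + c2) = (a1 - b1 - c1) + (a2 - b2 - c2) by ring.
  exact: E.
move=> j; have [Qj0 _] := QP j.
pose v := extend (fun i => (phi (f i)).@[y]) (phi (h j)).@[y].
have vE i : v i = (extend (phi \o f) (phi (h j)) i).@[y].
  by rewrite /v /extend; case: unlift.
have avp i : extend f (h j) i - (v i)%:A \in (p : {pred A}).
  by rewrite /v /extend; case: unlift => [k|]; apply: point_value.
have := taylor2 (Q j) pi avp.
have -> : aeval (extend f (h j)) (Q j) = 0.
  by apply: phi_eq0; rewrite lrmorph_aeval comp_extend.
have -> : (Q j).@[v] = 0.
  by rewrite (meval_eq _ vE) -meval_aeval Qj0 meval0.
rewrite scale0r subr0 sub0r big_ord_recr /= /v !extend_max -/v.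
set t := (Q j)^`M(ord_max).@[v].
have t0 : t != 0 by rewrite /t (meval_eq _ vE) -meval_aeval; exact: taujac_y.
move/(ideal_squareZ (- t^-1) pi) => sqF.
exists (fun i => - t^-1 * (Q j)^`M(widen_ord (leqnSn n) i).@[v]).
move: sqF; congr (ideal_square _ _).
rewrite scalerN scaleNr opprK scalerDr scalerA mulVf // scale1r addrC.
congr (_ + _); rewrite scaler_sumr -sumrN; apply: eq_bigr => i _.
by rewrite /v !extend_widen scalerA mulNr scaleNr opprK.
Qed.

Theorem generic_parameters :
  [/\ generic_local_parameters (range f), injective f, krull_dim A n
    & maximal_alg_independent (range f)].
Proof.
split; [| exact/aindep_inj/aindep_f | exact: krull_dim_n
  | exact: maximal_aindep_f].
exists [set p : max_spec A | jac \notin (p : {pred A})]; split.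
- exists [set jac]; apply/seteqP; split=> p /=; first by exists jac.
  by case=> _ ->.
- by have [p pj ps] := smooth_point; exists p.
- by move=> p [pj ps]; apply: range_local_parameters.
Qed.

End GenericParameters.

(** A countable set has Lebesgue measure 0, whereas [0, 1] has measure 1. *)
Lemma real_uncountable (R : realType) (S : set R) :
  countable S -> exists x, ~ S x.
Proof.
move=> S_count; apply: contrapT => /forallNP ST.
have : countable ([set` `[0, 1]%R] : set R).
  by apply: card_le_trans S_count; apply: subset_card_le => x _; exact: contrapT (ST x).
move/lebesgue_measure.countable_lebesgue_measure0.
rewrite lebesgue_measure.lebesgue_measure_itv /= constructive_ereal.lte_fin ltr01 oppr0 constructive_ereal.adde0.
by case=> /eqP; rewrite oner_eq0.
Qed.

Lemma complex_uncountable (R : realType) (S : set R[i]) :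
  countable S -> exists x, ~ S x.
Proof.
move=> S_count.
have [x xP] := real_uncountable (card_le_trans (card_image_le (@complex.Re R) S) S_count).
by exists (x%:C)%C => Sx; apply: xP; exists (x%:C)%C.
Qed.

(** * The slice *)

Section ThreeByThree.
Variable T : comNzRingType.

Definition mx3 (a b c d e f g h k : T) : 'M[T]_3 :=
  \matrix_(i, j) nth 0 (nth [::] [:: [:: a; b; c]; [:: d; e; f]; [:: g; h; k]] i) j.

Lemma mx3E a b c d e f g h k :
  let M := mx3 a b c d e f g h k in
  (M 0 0 = a) * (M 0 1 = b) * (M 0 2 = c) *
  (M 1 0 = d) * (M 1 1 = e) * (M 1 2 = f) *
  (M 2 0 = g) * (M 2 1 = h) * (M 2 2 = k).
Proof. by rewrite /= !mxE. Qed.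

Lemma matrix3P (A B : 'M[T]_3) :
  A 0 0 = B 0 0 -> A 0 1 = B 0 1 -> A 0 2 = B 0 2 ->
  A 1 0 = B 1 0 -> A 1 1 = B 1 1 -> A 1 2 = B 1 2 ->
  A 2 0 = B 2 0 -> A 2 1 = B 2 1 -> A 2 2 = B 2 2 -> A = B.
Proof.
move=> *; apply/matrixP => i j.
have ord3 (k : 'I_3) : [\/ k = 0, k = 1 | k = 2].
  by case: k => -[|[|[|//]]] lt_k3; [constructor 1 | constructor 2 | constructor 3];
    apply: val_inj.
by case: (ord3 i) => ->; case: (ord3 j) => ->.
Qed.

Lemma sum3 (V : nmodType) (F : 'I_3 -> V) : \sum_i F i = F 0 + F 1 + F 2.
Proof.
rewrite !big_ord_recr big_ord0 /= add0r.
by congr (F _ + F _ + F _); apply: val_inj.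
Qed.

Lemma mulmx3E (A B : 'M[T]_3) i j :
  (A *m B) i j = A i 0 * B 0 j + A i 1 * B 1 j + A i 2 * B 2 j.
Proof. by rewrite mxE sum3. Qed.

Lemma det3E (M : 'M[T]_3) :
  \det M = M 0 0 * (M 1 1 * M 2 2 - M 1 2 * M 2 1)
         - M 0 1 * (M 1 0 * M 2 2 - M 1 2 * M 2 0)
         + M 0 2 * (M 1 0 * M 2 1 - M 1 1 * M 2 0).
Proof.
rewrite (expand_det_row _ 0) sum3 /cofactor !(expand_det_row _ 0).
rewrite !big_ord_recl !big_ord0 /cofactor !det_mx11 !mxE /=.
have -> : lift (lift ord0 ord0 : 'I_2) (0 : 'I_1) = 0 by exact: val_inj.
have -> : lift (0 : 'I_3) (0 : 'I_2) = 1 by exact: val_inj.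
have -> : lift (0 : 'I_3) (lift (0 : 'I_2) 0) = 2 by exact: val_inj.
have -> : lift (1 : 'I_3) (0 : 'I_2) = 0 by exact: val_inj.
have -> : lift (1 : 'I_3) (lift (0 : 'I_2) 0) = 2 by exact: val_inj.
have -> : lift (2 : 'I_3) (0 : 'I_2) = 0 by exact: val_inj.
have -> : lift (2 : 'I_3) (lift (0 : 'I_2) 0) = 1 by exact: val_inj.
rewrite /bump /=.
have -> : (0 + (1 %% 3 + 1 %% 3) %% 3 = 2)%N by [].
have -> : (0 + 1 %% 3 = 1)%N by [].
by rewrite expr0 expr1; ring.
Qed.

End ThreeByThree.

Lemma map_mx3 (T U : comNzRingType) (phi : T -> U) a b c d e f g h k :
  map_mx phi (mx3 a b c d e f g h k) =
  mx3 (phi a) (phi b) (phi c) (phi d) (phi e) (phi f) (phi g) (phi h) (phi k).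
Proof. by apply: matrix3P; rewrite mxE !mx3E. Qed.

(** * Density along rational curves *)

Section Irreducibility.
Variables (R : realType) (r : nat).
Local Notation K := R[i].
Implicit Types (M : SL3r R r) (P Q : {mpoly K[#|{: Defs.coord r}|]}).


Lemma clear_denominators N (x : 'I_N -> K -> K) (d : {poly K}) :
  (forall i, exists q : {poly K}, forall t, d.[t] != 0 -> d.[t] * x i t = q.[t]) ->
  forall P : {mpoly K[N]}, exists e (q : {poly K}), forall t, d.[t] != 0 ->
    d.[t] ^+ e * P.@[fun i => x i t] = q.[t].
Proof.
move=> xP; elim/mpoly_ring_ind => [c|i|p q IHp IHq|p q IHp IHq].
- by exists 0%N, c%:P => t _; rewrite mevalC hornerC mul1r.
- have [q qE] := xP i; exists 1%N, q => t /qE <-.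
  by rewrite mevalXU.
- have [[e [u uE]] [e' [u' uE']]] := (IHp, IHq).
  exists (e + e')%N, (d ^+ e' * u + d ^+ e * u') => t dt.
  rewrite mevalD hornerD !hornerM !horner_exp -uE // -uE' //.
  by rewrite exprD; ring.
- have [[e [u uE]] [e' [u' uE']]] := (IHp, IHq).
  exists (e + e')%N, (u * u') => t dt.
  by rewrite mevalM hornerM -uE // -uE' // exprD; ring.
Qed.

Definition segment (U : comNzRingType) (M N : 'M[U]_3) (t : U) : 'M[U]_3 :=
  (1 - t) *: M + t *: N.

(** Only the last column is rescaled, so along a segment the first two columns stay affine in t. *)
Definition normalize (M : 'M[K]_3) : 'M[K]_3 :=
  \matrix_(i, j) if j == 2 then (\det M)^-1 * M i j else M i j.

Lemma det_normalize (M : 'M[K]_3) : \det M != 0 -> \det (normalize M) == 1.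
Proof.
move=> M0; apply/eqP; rewrite -[RHS](mulVf M0) [X in _ = _ * X]det3E det3E !mxE /=.
by ring.
Qed.

Lemma normalize_id (M : 'M[K]_3) : \det M = 1 -> normalize M = M.
Proof.
by move=> M1; apply/matrixP => i j; rewrite mxE M1 invr1 mul1r if_same.
Qed.

Definition segment_closed (F : SL3r R r -> Prop) :=
  forall M N L t, F M -> F N ->
    (forall k, val (L k) = normalize (segment (val (M k)) (val (N k)) t)) -> F L.

(* The points of a segment-closed family that lie on the rational curve       *)
(* through [M] and [N] meet both nonvanishing loci.                           *)
Lemma segment_closed_irreducible F P Q M N :
  segment_closed F -> F M -> F N ->
  P.@[coord_values M] != 0 -> Q.@[coord_values N] != 0 ->
  exists L, [/\ F L, P.@[coord_values L] != 0 & Q.@[coord_values L] != 0].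
Proof.
move=> F_closed FM FN PM QN.
pose S k (t : K) := segment (val (M k)) (val (N k)) t.
pose SX k := segment (map_mx polyC (val (M k))) (map_mx polyC (val (N k))) 'X.
pose d k := \det (SX k).
have SXE k i j t : (SX k i j).[t] = S k t i j.
  by rewrite !mxE !hornerE.
have dE k t : (d k).[t] = \det (S k t).
  by rewrite /d !det3E !hornerE !SXE.
(* A common denominator for all components; it equals 1 at both ends of the curve. *)
pose D := \prod_k d k.
have D_neq0 t k : D.[t] != 0 -> (d k).[t] != 0.
  by apply: contra => /eqP dk0; rewrite /D (bigD1 k) //= hornerM dk0 mul0r.
pose x (i : 'I_#|{: Defs.coord r}|) t :=
  let: (k, a, b) := enum_val i in normalize (S k t) a b.
have xP i : exists q : {poly K}, forall t, D.[t] != 0 -> D.[t] * x i t = q.[t].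
  rewrite /x; case: (enum_val i) => -[k a] b.
  have [->|b2] := eqVneq b 2; last first.
    by exists (D * SX k a b) => t _; rewrite hornerM SXE mxE (negPf b2).
  exists (\prod_(l | l != k) d l * SX k a 2) => t Dt.
  rewrite mxE eqxx /D (bigD1 k) //= !hornerM SXE -dE.
  by rewrite mulrACA divff ?D_neq0 ?mul1r.
have [e [p pE]] := clear_denominators xP P.
have [e' [q qE]] := clear_denominators xP Q.
have SL_end (W : SL3r R r) t : (forall k, S k t = val (W k)) ->
    D.[t] = 1 /\ (fun i => x i t) = coord_values W.
  move=> SW; have detS k : \det (S k t) = 1 by rewrite SW (eqP (valP (W k))).
  split; first by rewrite horner_prod big1 // => k _; rewrite dE detS.
  apply: funext => i; rewrite /x /coord_values; case: (enum_val i) => -[k a] b.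
  by rewrite normalize_id // SW.
have [D0 x0] : D.[0] = 1 /\ (fun i => x i 0) = coord_values M.
  by apply: SL_end => k; rewrite /S /segment subr0 scale1r scale0r addr0.
have [D1 x1] : D.[1] = 1 /\ (fun i => x i 1) = coord_values N.
  by apply: SL_end => k; rewrite /S /segment subrr scale1r scale0r add0r.
have p0 : p.[0] != 0 by rewrite -pE ?D0 ?oner_eq0 // expr1n mul1r x0.
have q1 : q.[1] != 0 by rewrite -qE ?D1 ?oner_eq0 // expr1n mul1r x1.
(* No factor is the zero polynomial: D(0) = 1, p is nonzero at the end M and q at the end N. *)
have /closed_nonrootP[t] : D * p * q != 0.
  rewrite !mulf_neq0 //; [apply: contra_eq_neq D0 => -> | apply: contraNneq p0 => ->
    | apply: contraNneq q1 => ->]; rewrite ?horner0 //.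
  by rewrite eq_sym oner_eq0.
rewrite rootE !hornerM !mulf_eq0 !negb_or => /andP[/andP[Dt pt] qt].
have SLt k : \det (normalize (S k t)) == 1.
  by rewrite det_normalize // -dE D_neq0.
pose L : SL3r R r := fun k => exist (fun A : 'M[K]_3 => \det A == 1) _ (SLt k).
have LE : (fun i => x i t) = coord_values L by [].
exists L; split; first exact: (F_closed M N L t).
  by apply: contraNneq pt => PL; rewrite -pE // LE PL mulr0.
by apply: contraNneq qt => QL; rewrite -qE // LE QL mulr0.
Qed.

Lemma regular_eq0 F (a : SL3r R r -> R[i]^o) Q N :
  segment_closed F -> regular a -> F N -> Q.@[coord_values N] != 0 ->
  (forall M, F M -> Q.@[coord_values M] != 0 -> a M = 0) ->
  forall M, F M -> a M = 0.
Proof.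
move=> F_closed [P aE] FN QN a0 M FM; apply/eqP/negPn/negP => aM.
have PM : P.@[coord_values M] != 0 by rewrite -aE.
have [L [FL PL QL]] := segment_closed_irreducible F_closed FM FN PM QN.
by move: PL; rewrite -aE a0 ?eqxx.
Qed.

End Irreducibility.

(** * Polynomial parametrisation of the slice *)

Section SliceMatrices.
Variable T : comNzRingType.

Definition slice1 (s t : T) : 'M[T]_3 := mx3 0 0 1 1 0 s 0 1 t.

(** After adding m times the second row to the first, the rows 0 and 2 contain the unimodular 2 by 2
    block U(a) L(b) U(c), a product of elementary matrices; hence the determinant is identically 1
    without division. [slice3] uses the block U(p) L(q) U(w) in the same way. *)
Definition slice2 (m s t a b c : T) : 'M[T]_3 :=
  mx3 m (1 + a * b - m * s) (a + c + a * b * c - m * t)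
      (- 1) s t
      0 b (1 + b * c).

Definition slice3 (a b c u v p q w : T) : 'M[T]_3 :=
  mx3 (1 + a * b) a 0 b 1 0 c 0 1 *m
  mx3 1 u v 0 (1 + p * q) (p + w + p * q * w) 0 q (1 + q * w).

(** The parameters form r - 1 blocks of 8: block 0 is shared by the first two matrices (2 + 6), and
    block k - 1 belongs to the matrix of index k >= 2. *)
Definition slice_mx (y : nat -> nat -> T) (k : nat) : 'M[T]_3 :=
  match k with
  | 0 => slice1 (y 0 0) (y 0 1)
  | 1 => slice2 (y 0 2) (y 0 3) (y 0 4) (y 0 5) (y 0 6) (y 0 7)
  | b.+1 => slice3 (y b 0) (y b 1) (y b 2) (y b 3) (y b 4) (y b 5) (y b 6) (y b 7)
  end%N.

Lemma det_slice_mx y k : \det (slice_mx y k) = 1.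
Proof.
case: k => [|[|k]]; rewrite /= ?det_mulmx !det3E !mx3E; ring.
Qed.

(* Nonvanishing of [slice3_open M] characterises, among the unimodular        *)
(* matrices, those in the range of [slice3] with [b q <> 0].                  *)
Definition slice3_open (M : 'M[T]_3) : T :=
  M 1 0 * (M 1 0 * M 2 1 - M 2 0 * M 1 0 * M 0 1 + M 2 0 * (M 0 0 - 1) * M 1 1).

End SliceMatrices.

Lemma map_slice_mx (T U : comNzRingType) (phi : {rmorphism T -> U}) y k :
  map_mx phi (slice_mx y k) = slice_mx (fun b c => phi (y b c)) k.
Proof.
case: k => [|[|k]]; rewrite /= ?/slice3 ?map_mxM /= !map_mx3;
by rewrite ?(rmorphB, rmorphD, rmorphM, rmorphN, rmorph1, rmorph0).
Qed.

Lemma slice2P (F : fieldType) (M : 'M[F]_3) :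
  \det M = 1 -> M 1 0 = -1 -> M 2 0 = 0 -> M 2 1 != 0 ->
  let m := M 0 0 in let s := M 1 1 in let t := M 1 2 in let b := M 2 1 in
  M = slice2 m s t ((M 0 1 + m * s - 1) / b) b ((M 2 2 - 1) / b).
Proof.
move=> detM M10 M20 M21 m s t b; rewrite det3E M10 M20 in detM.
apply: matrix3P; rewrite mx3E //.
- by rewrite divfK // ; ring.
- have M02 : M 0 2 = (M 0 1 * M 2 2 - m * t * b + m * s * M 2 2 - 1) / b.
    apply: (canRL (mulfK M21)); rewrite -[in RHS]detM /m /s /t /b; ring.
  rewrite M02; field; exact: M21.
- by rewrite mulrC divfK //; ring.
Qed.

Lemma slice3P (F : fieldType) (M : 'M[F]_3) :
  \det M = 1 -> slice3_open M != 0 ->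
  exists a b c u v p q w, M = slice3 a b c u v p q w.
Proof.
move=> detM; rewrite mulf_eq0 negb_or => /andP[M10 Mq]; rewrite det3E in detM.
pose b := M 1 0; pose c := M 2 0; pose a := (M 0 0 - 1) / b.
(* Entries of the second factor, obtained by multiplying M on the left by the inverse of the
   first. *)
pose u := M 0 1 - a * M 1 1; pose v := M 0 2 - a * M 1 2.
pose p' := M 0 0 * M 1 1 - b * M 0 1.
pose q := M 2 1 - c * M 0 1 + c * a * M 1 1.
pose w' := M 2 2 - c * M 0 2 + c * a * M 1 2.
have bq : b * q = M 1 0 * M 2 1 - M 2 0 * M 1 0 * M 0 1 + M 2 0 * (M 0 0 - 1) * M 1 1.
  by rewrite /q /a /c /b; field.
have q0 : q != 0 by apply: contraNneq Mq => q0; rewrite -bq q0 mulr0.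
exists a, b, c, u, v, ((p' - 1) / q), q, ((w' - 1) / q).
have b0 : b != 0 by [].
have pq : 1 + (p' - 1) / q * q = p' by rewrite divfK //; ring.
have qw : 1 + q * ((w' - 1) / q) = w' by rewrite mulrC divfK //; ring.
have pw : (p' - 1) / q + (w' - 1) / q + (p' - 1) / q * q * ((w' - 1) / q) =
    M 0 0 * M 1 2 - b * M 0 2.
  have : p' * w' - (M 0 0 * M 1 2 - b * M 0 2) * q = 1.
    by rewrite -[RHS]detM /p' /w' /q /a /c /b; field.
  move/eqP; rewrite subr_eq => /eqP pw.
  have -> : (p' - 1) / q + (w' - 1) / q + (p' - 1) / q * q * ((w' - 1) / q) =
     (p' * w' - 1) / q by field.
  by rewrite pw addrC addKr mulfK.
rewrite /slice3 pq qw pw.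
apply: matrix3P; rewrite mulmx3E !mx3E /u /v /p' /q /w' /a /c; rewrite -/b.
all: try by field.
Qed.

Section Slice.
Variables (R : realType) (r : nat).
Local Notation K := R[i].
Local Notation N := #|{: 'I_r.-1 * 'I_8}|.

Definition param (T : comNzRingType) (z : 'I_N -> T) (b c : nat) : T :=
  match insub b, insub c with
  | Some b', Some c' => z (enum_rank (b', c'))
  | _, _ => 0
  end.

Definition tabulate (T : Type) (w : nat -> nat -> T) (i : 'I_N) : T :=
  let: (b, c) := enum_val i in w b c.

Lemma paramE (T : comNzRingType) (w : nat -> nat -> T) b c :
  (b < r.-1)%N -> (c < 8)%N -> param (tabulate w) b c = w b c.
Proof.
move=> br c8; rewrite /param (insubT (fun b => b < r.-1)%N br).
by rewrite (insubT (fun c => c < 8)%N c8) /tabulate enum_rankK.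
Qed.

Lemma rmorph_param (T U : comNzRingType) (phi : {rmorphism T -> U}) z b c :
  phi (param z b c) = param (phi \o z) b c.
Proof.
rewrite /param; case: (insub b : option 'I_r.-1) => [b'|]; last exact: rmorph0.
by case: (insub c : option 'I_8) => [c'|] //; exact: rmorph0.
Qed.

Lemma det_slice (z : 'I_N -> K) (k : 'I_r) : \det (slice_mx (param z) k) == 1.
Proof. by rewrite det_slice_mx. Qed.

Definition slice (z : 'I_N -> K) : SL3r R r :=
  fun k => exist (fun A : 'M[K]_3 => \det A == 1) _ (det_slice z k).

Definition slice_coord (x : 'I_#|{: Defs.coord r}|) : {mpoly K[N]} :=
  let: (k, i, j) := enum_val x in slice_mx (param (fun l => 'X_l)) k i j.

Lemma slice_coordE z x : (slice_coord x).@[z] = coord_values (slice z) x.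
Proof.
rewrite /slice_coord /coord_values; case: (enum_val x) => -[k i] j /=.
transitivity (map_mx (meval z) (slice_mx (param (fun l => 'X_l)) k) i j).
  by rewrite mxE.
rewrite map_slice_mx.
suff -> : (fun b c => (param (fun l => 'X_l) b c).@[z]) = param z by [].
apply: funext => b; apply: funext => c; rewrite rmorph_param.
by congr (param _ _ _); apply: funext => l /=; rewrite mevalXU.
Qed.

Lemma restrict_exists (a : char_ring R r) :
  exists q : {mpoly K[N]}, forall z, q.@[z] = a (slice z).
Proof.
have /char_funP[[P aE] _] := valP a.
exists (aeval slice_coord P) => z.
by rewrite aE meval_aeval; apply: meval_eq => x; exact: slice_coordE.
Qed.

(** The chosen polynomial is unique, being determined by its values; this makes the restriction a
    morphism of algebras. *)
Definition restrict (a : char_ring R r) : {mpoly K[N]} :=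
  sval (cid (restrict_exists a)).

Lemma restrictE a z : (restrict a).@[z] = a (slice z).
Proof. by rewrite /restrict; case: cid. Qed.

Let mpoly_ext := meval_inj (@complex_uncountable R).

Lemma restrict_is_zmod_morphism : zmod_morphism restrict.
Proof. by move=> a b; apply: mpoly_ext => z; rewrite mevalB !restrictE. Qed.

Lemma restrict_is_monoid_morphism : monoid_morphism restrict.
Proof.
split=> [|a b]; apply: mpoly_ext => z; first by rewrite meval1 restrictE.
by rewrite mevalM !restrictE.
Qed.

Lemma restrict_is_scalable : scalable restrict.
Proof. by move=> c a; apply: mpoly_ext => z; rewrite mevalZ !restrictE. Qed.

HB.instance Definition _ :=
  GRing.isZmodMorphism.Build (char_ring R r) {mpoly K[N]} restrict
    restrict_is_zmod_morphism.
HB.instance Definition _ :=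
  GRing.isMonoidMorphism.Build (char_ring R r) {mpoly K[N]} restrict
    restrict_is_monoid_morphism.
HB.instance Definition _ :=
  GRing.isScalable.Build K (char_ring R r) {mpoly K[N]} *:%R restrict
    restrict_is_scalable.

Variable r_ge2 : (2 <= r)%N.
Local Notation k1 := (i1 r_ge2).
Local Notation k2 := (i2 r_ge2).

Lemma meval_generic (M : SL3r R r) k i j :
  (generic_mx R k i j).@[coord_values M] = val (M k) i j.
Proof. by rewrite mxE mevalXU /coord_values enum_rankK. Qed.

(* The pairs in normal form with respect to a basis [v, A v, A^2 v], where    *)
(* [v] is an eigenvector of the sum of the pair.                              *)
Definition normal_pair (M : SL3r R r) : Prop :=
  [/\ val (M k1) 0 0 = 0, val (M k1) 1 0 = 1 & val (M k1) 2 0 = 0] /\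
  [/\ val (M k1) 0 1 = 0, val (M k1) 1 1 = 0 & val (M k1) 2 1 = 1] /\
  (val (M k2) 1 0 = -1 /\ val (M k2) 2 0 = 0).

(** The conditions fix entries of the first two columns only, which [normalize] leaves alone. *)
Lemma normal_pair_closed : segment_closed normal_pair.
Proof.
move=> M M' L t FM FM' LE.
have affine k i j c : j != 2 -> val (M k) i j = c -> val (M' k) i j = c ->
    val (L k) i j = c.
  by move=> j2 Mc M'c; rewrite LE mxE (negPf j2) !mxE Mc M'c; ring.
case: FM FM' => [[a1 a2 a3] [[a4 a5 a6] [a7 a8]]].
move=> [[b1 b2 b3] [[b4 b5 b6] [b7 b8]]].
split; [split|split; [split|split]].
- exact: affine a1 b1.
- exact: affine a2 b2.
- exact: affine a3 b3.
- exact: affine a4 b4.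
- exact: affine a5 b5.
- exact: affine a6 b6.
- exact: affine a7 b7.
- exact: affine a8 b8.
Qed.

Lemma slice_normal_pair z : normal_pair (slice z).
Proof. by rewrite /normal_pair /= !mx3E. Qed.

Definition slice_open : {mpoly K[#|{: Defs.coord r}|]} :=
  generic_mx R k2 2 1 * \prod_(k < r | (2 <= k)%N) slice3_open (generic_mx R k).

Lemma slice_openE (M : SL3r R r) : slice_open.@[coord_values M] =
  val (M k2) 2 1 * \prod_(k < r | (2 <= k)%N) slice3_open (val (M k)).
Proof.
rewrite mevalM meval_generic; congr (_ * _).
rewrite rmorph_prod; apply: eq_bigr => k _; rewrite /slice3_open /=.
by rewrite !(mevalM, mevalB, mevalD, meval1, meval_generic).
Qed.

Lemma normal_pair_slice (M : SL3r R r) :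
  normal_pair M -> slice_open.@[coord_values M] != 0 -> exists z, M = slice z.
Proof.
move=> [[a1 a2 a3] [[a4 a5 a6] [a7 a8]]]; rewrite slice_openE mulf_eq0 negb_or.
move=> /andP[M21 /prodf_neq0 M_open].
have det1 k : \det (val (M k)) = 1 by exact/eqP/(valP (M k)).
suff [w wE] : exists w : nat -> nat -> K, forall k : 'I_r, val (M k) = slice_mx w k.
  exists (tabulate w).
  apply: funext => k; apply: val_inj; rewrite /= wE.
  have r1 : (0 < r.-1)%N by case: (r) r_ge2 => [|[]].
  case: k => -[|[|k]] /= kr; rewrite !paramE //; lia.
have /fin_all_exists[w wE] (b : 'I_r) : exists w : nat -> K, (2 <= b)%N ->
    val (M b) = slice3 (w 0%N) (w 1%N) (w 2%N) (w 3%N) (w 4%N) (w 5%N) (w 6%N) (w 7%N).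
  have [b2|_] := boolP (2 <= b)%N; last by exists (fun=> 0).
  have [x0 [x1 [x2 [x3 [x4 [x5 [x6 [x7 ->]]]]]]]] := slice3P (det1 b) (M_open b b2).
  by exists (nth 0 [:: x0; x1; x2; x3; x4; x5; x6; x7]).
have M2E := slice2P (det1 k2) a7 a8 M21.
set A := val (M k1); set B := val (M k2) in M2E *.
exists (fun b c => if b == 0%N then nth 0 [:: A 1 2; A 2 2; B 0 0; B 1 1; B 1 2;
    (B 0 1 + B 0 0 * B 1 1 - 1) / B 2 1; B 2 1; (B 2 2 - 1) / B 2 1] c
  else if insub b.+1 is Some k then w k c else 0).
move=> k; case: (ltnP k 2) => [k2|k2].
  case: k k2 => -[|[|//]] kr _ /=.
    rewrite (_ : Ordinal kr = k1); last exact: val_inj.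
    have := det1 k1; rewrite det3E -/A a1 a2 a3 a4 a5 a6 => detA.
    apply: matrix3P; rewrite mx3E //.
    by rewrite -[RHS]detA; ring.
  by rewrite (_ : Ordinal kr = k2) //; exact: val_inj.
rewrite wE //; case: k k2 => -[|[|k]] //= kr _.
by rewrite insubT.
Qed.

Lemma restrict_normal_pair a (M : SL3r R r) :
  restrict a = 0 -> normal_pair M -> (a : char_ring R r) M = 0.
Proof.
move=> a0; have /char_funP[a_reg _] := valP a.
apply: (regular_eq0 (Q := slice_open) (N := slice (tabulate (fun _ _ => 1))) normal_pair_closed a_reg).
- exact: slice_normal_pair.
- rewrite slice_openE /= mx3E.
  rewrite paramE ?mul1r //; last by case: (r) r_ge2 => [|[]].
  apply/prodf_neq0 => -[[|[|k]] kr] //= _.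
  rewrite !paramE //; [|lia ..].
  rewrite (_ : slice3_open _ = 1) ?oner_eq0 //.
  by rewrite /slice3_open /slice3 !mulmx3E !mx3E; ring.
- by move=> L FL /(normal_pair_slice FL)[z ->]; have := restrictE a z; rewrite a0 meval0.
Qed.

End Slice.

(** * Words spanning the matrix algebra *)

Section WordBasis.
Variable T : comNzRingType.

Definition word_basis (A B : 'M[T]_3) : 'M[T]_(3 * 3) :=
  \matrix_(x < 3 * 3) mxvec (A ^+ (x %/ 3) *m B ^+ (x %% 3)).

Lemma mxvec_dot (X Y : 'M[T]_3) :
  (mxvec X *m (mxvec Y)^T) 0 0 = \sum_i \sum_j X i j * Y i j.
Proof.
rewrite mxE (reindex _ (curry_mxvec_bij _ _)) pair_big /=.
by apply: eq_bigr => -[i j] _; rewrite mxE !mxvecE.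
Qed.

End WordBasis.

Lemma map_word_basis (T U : comNzRingType) (phi : {rmorphism T -> U}) A B :
  map_mx phi (word_basis A B) = word_basis (map_mx phi A) (map_mx phi B).
Proof.
apply/row_matrixP => x; rewrite -map_row !rowK map_mxvec map_mxM.
by rewrite !rmorphXn.
Qed.

Section WordBasisField.
Variable F : fieldType.
Implicit Types (A B : 'M[F]_3).

Lemma word_basis_det0P A B :
  reflect (exists2 X : 'M_3, X != 0 & forall i j, (i < 3)%N -> (j < 3)%N ->
      \sum_p \sum_q X p q * (A ^+ i *m B ^+ j) p q = 0)
    (\det (word_basis A B) == 0).
Proof.
rewrite -det_tr; apply: (iffP det0P) => [[w w0 wB]|[X X0 XB]].
  exists (vec_mx w); first by apply: contra w0 => /eqP w0; rewrite -(vec_mxK w) w0 linear0.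
  move=> i j i3 j3; have x9 : (i * 3 + j < 3 * 3)%N by lia.
  have /rowP/(_ (Ordinal x9)) := wB; rewrite [RHS]mxE => wB0; rewrite -[RHS]wB0.
  rewrite -mxvec_dot vec_mxK !mxE; apply: eq_bigr => y _; rewrite !mxE /=.
  by rewrite divnMDl // modnMDl (divn_small j3) (modn_small j3) addn0.
exists (mxvec X); first by apply: contra X0 => /eqP X0; rewrite -(mxvecK X) X0 linear0.
apply/rowP => x; rewrite [RHS]mxE -[RHS](XB (x %/ 3)%N (x %% 3)%N); first last.
- by rewrite ltn_mod.
- by rewrite ltn_divLR.
by rewrite -mxvec_dot !mxE; apply: eq_bigr => y _; rewrite !mxE.
Qed.

(** If l kills v, A v and A^2 v, then l A^i B^j v = m^j l A^i v = 0, so the rank-one matrix l^T v^T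
    is orthogonal to all nine words A^i B^j, which then do not span. *)
Lemma word_basis_cyclic A B (l : 'rV_3) (v : 'cV_3) m :
  \det (word_basis A B) != 0 -> B *m v = m *: v -> v != 0 ->
  (forall i, (i < 3)%N -> l *m (A ^+ i *m v) = 0) -> l = 0.
Proof.
move=> AB Bv v0 lv; apply: contraNeq AB => l0; apply/word_basis_det0P.
exists (l^T *m v^T) => [|i j i3 _].
  apply: contra l0 => /eqP lv0; apply/eqP/rowP => i.
  have [k vk] : exists k, v k 0 != 0.
    apply: contrapT => /forallNP v00; move: v0 => /negP; apply; apply/eqP/colP => k.
    by rewrite mxE; apply/eqP; apply: contrapT => /negP/v00.
  apply/eqP; rewrite mxE; have /matrixP/(_ i k)/eqP := lv0.
  by rewrite !mxE big_ord1 !mxE mulf_eq0 (negPf vk) orbF.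
rewrite -mxvec_dot mxvec_dotmul trmxK.
have -> : A ^+ i *m B ^+ j = A ^+ i * B ^+ j by [].
have Bjv : B ^+ j *m v = m ^+ j *: v.
  elim: j => [|j IH]; first by rewrite !expr0 mul1mx scale1r.
  by rewrite !exprS -mulmxE -mulmxA IH -scalemxAr Bv scalerA mulrC.
by rewrite -mulmxE -!mulmxA Bjv -!scalemxAr lv // scaler0 mxE.
Qed.

End WordBasisField.

(** * Generic tuples are conjugate to normal form *)

Section Density.
Variables (R : realType) (r : nat).
Local Notation K := R[i].
Variable r_ge2 : (2 <= r)%N.
Local Notation k1 := (i1 r_ge2).
Local Notation k2 := (i2 r_ge2).

Lemma right_eigenvector (B : 'M[K]_3) :
  exists m (v : 'cV_3), B *m v = m *: v /\ v != 0.
Proof.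
have /closed_rootP[m] : size (char_poly B^T) != 1%N by rewrite size_char_poly.
rewrite -eigenvalue_root_char => /eigenvalueP[v vB v0].
exists m, v^T; split; last by apply: contra v0 => /eqP v0; rewrite -[v]trmxK v0 trmx0.
by rewrite -[B]trmxK -trmx_mul vB linearZ.
Qed.

(** In the basis v, A v, A^2 v, where v is an eigenvector of A + A2 with eigenvalue m, the matrix A
    sends the first two basis vectors to the next ones and A2 v = m v - A v has coordinates (m, -1,
    0). A cube root rescales the change of basis to determinant 1. *)
Lemma conj_normal_pair (M : SL3r R r) :
  \det (word_basis (val (M k1)) (val (M k1) + val (M k2))) != 0 ->
  exists g : SL3 R, normal_pair r_ge2 (fun k => SL3_conj g (M k)).
Proof.
set A := val (M k1); set A2 := val (M k2) => AB.
have [m [v [Bv v0]]] := right_eigenvector (A + A2).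
pose P : 'M[K]_3 := \matrix_(i, j) (A ^+ j *m v) i 0.
have colP j : col j P = A ^+ j *m v.
  by apply/colP => i; rewrite !mxE.
have detP : \det P != 0.
  apply/det0P => -[l l0 lP]; case/eqP: l0.
  apply: (word_basis_cyclic AB Bv v0) => i i3.
  have -> : A ^+ i *m v = P *m delta_mx (Ordinal i3) 0 by rewrite -colE colP.
  by rewrite mulmxA lP mul0mx.
pose c := 3.-root (\det P)^-1; pose G := c *: P.
have detG : \det G = 1 by rewrite detZ rootCK // mulVf.
have Gu : G \in unitmx by rewrite unitmxE detG unitr1.
have detGV : \det (invmx G) == 1 by rewrite det_inv detG invr1.
pose g : SL3 R := exist (fun X : 'M[K]_3 => \det X == 1) _ detGV.
have colG j : G *m delta_mx j 0 = c *: (A ^+ j *m v).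
  by rewrite -scalemxAl -colE colP.
have conjE k i j : val (SL3_conj g (M k)) i j =
    (invmx G *m (val (M k) *m (c *: (A ^+ j *m v)))) i 0.
  rewrite -colG.
  rewrite [val (SL3_conj _ _)]/(invmx G *m val (M k) *m invmx (invmx G)).
  by rewrite invmxK !mulmxA -colE [RHS]mxE.
have GV (j : 'I_3) : invmx G *m (c *: (A ^+ j *m v)) = delta_mx j 0.
  by rewrite -colG mulKmx.
have G0 : invmx G *m (c *: v) = delta_mx 0 0.
  by have := GV 0; rewrite expr0 mul1mx.
have G1 : invmx G *m (c *: (A *m v)) = delta_mx 1 0.
  by have := GV 1; rewrite expr1.
have G2 : invmx G *m (c *: (A *m (A *m v))) = delta_mx 2 0.
  by have := GV 2; rewrite expr2 -mulmxE -mulmxA.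
have A0 i : val (SL3_conj g (M k1)) i 0 = (i == 1)%:R.
  by rewrite conjE expr0 mul1mx -/A -scalemxAr G1 mxE andbT.
have A1 i : val (SL3_conj g (M k1)) i 1 = (i == 2)%:R.
  by rewrite conjE expr1 -/A -scalemxAr G2 mxE andbT.
have A20 i : val (SL3_conj g (M k2)) i 0 = m * (i == 0)%:R - (i == 1)%:R.
  have A2v : A2 *m (c *: v) = m *: (c *: v) - c *: (A *m v).
    rewrite -[A2](addKr A) mulmxDl mulNmx -!scalemxAr Bv addrC.
    by rewrite !scalerA mulrC.
  by rewrite conjE expr0 mul1mx -/A2 A2v mulmxBr -scalemxAr G0 G1 !mxE !andbT.
exists g; rewrite /normal_pair !A0 !A1 !A20.
by rewrite !mulr0 !sub0r oppr0.
Qed.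

Lemma det_cyclic3 : \det (mx3 0 0 1 1 0 0 0 1 0 : 'M[K]_3) == 1.
Proof. by apply/eqP; rewrite det3E !mx3E; ring. Qed.

(** This is diag(1, -1, -2) minus the cyclic matrix. The diagonal entries are distinct with product
    2, and the determinant of such a difference is their product minus 1. *)
Lemma det_diag_sub_cyclic3 :
  \det (mx3 1 0 (-1) (-1) (-1) 0 0 (-1) (- 2) : 'M[K]_3) == 1.
Proof. by apply/eqP; rewrite det3E !mx3E; ring. Qed.

Lemma vandermonde3 (x y z : K) :
  x + y + z = 0 -> x - y - 2 * z = 0 -> x + y + 4 * z = 0 ->
  [/\ x = 0, y = 0 & z = 0].
Proof.
move=> e0 e1 e2.
have two : (2 : K) != 0 by rewrite pnatr_eq0.
have three : (3 : K) != 0 by rewrite pnatr_eq0.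
have z0 : z = 0.
  apply: (mulfI three); rewrite mulr0.
  rewrite (_ : 3 * z = (x + y + 4 * z) - (x + y + z)); last by ring.
  by rewrite e0 e2 subrr.
rewrite z0 in e0 e1; have y0 : y = 0.
  apply: (mulfI two); rewrite mulr0.
  rewrite (_ : 2 * y = (x + y + 0) - (x - y - 2 * 0)); last by ring.
  by rewrite e0 e1 subrr.
by split=> //; move: e0; rewrite y0 !addr0.
Qed.

Let cyc : 'M[K]_3 := mx3 0 0 1 1 0 0 0 1 0.
Let dia (x y z : K) : 'M[K]_3 := mx3 x 0 0 0 y 0 0 0 z.

(** The powers of [cyc] have disjoint supports, so orthogonality to the nine words splits into three
    Vandermonde systems with nodes 1, -1, -2. *)
Lemma word_basis_cyclic_diag : \det (word_basis cyc (dia 1 (-1) (- 2))) != 0.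
Proof.
apply/word_basis_det0P => -[X + XB]; apply/negP; rewrite negbK; apply/eqP.
have dia_exp j : dia 1 (-1) (- 2) ^+ j = dia 1 ((-1) ^+ j) ((- 2) ^+ j).
  elim: j => [|j IH].
    by rewrite !expr0; apply: matrix3P; rewrite mx3E mxE.
  rewrite !exprS IH -mulmxE.
  by apply: matrix3P; rewrite mulmx3E !mx3E; ring.
have dot a b c d e f g h k :
    \sum_p \sum_q X p q * mx3 a b c d e f g h k p q =
    X 0 0 * a + X 0 1 * b + X 0 2 * c + (X 1 0 * d + X 1 1 * e + X 1 2 * f) +
    (X 2 0 * g + X 2 1 * h + X 2 2 * k).
  by rewrite !sum3 !mx3E.
have row0 j : (j < 3)%N ->
    X 0 0 + X 1 1 * (-1) ^+ j + X 2 2 * (- 2) ^+ j = 0.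
  move=> /(XB 0 j isT); rewrite expr0 mul1mx dia_exp dot => e.
  by rewrite -[RHS]e; ring.
have row1 j : (j < 3)%N ->
    X 1 0 + X 2 1 * (-1) ^+ j + X 0 2 * (- 2) ^+ j = 0.
  move=> /(XB 1 j isT); rewrite expr1 dia_exp.
  rewrite (_ : cyc *m _ = mx3 0 0 ((- 2) ^+ j) 1 0 0 0 ((-1) ^+ j) 0).
    by rewrite dot => e; rewrite -[RHS]e; ring.
  by apply: matrix3P; rewrite mulmx3E !mx3E; ring.
have row2 j : (j < 3)%N ->
    X 2 0 + X 0 1 * (-1) ^+ j + X 1 2 * (- 2) ^+ j = 0.
  move=> /(XB 2 j isT); rewrite expr2 dia_exp -mulmxE -mulmxA.
  rewrite [cyc *m dia _ _ _](_ : _ = mx3 0 0 ((- 2) ^+ j) 1 0 0 0 ((-1) ^+ j) 0).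
    rewrite (_ : cyc *m _ = mx3 0 ((-1) ^+ j) 0 0 0 ((- 2) ^+ j) 1 0 0).
      by rewrite dot => e; rewrite -[RHS]e; ring.
    by apply: matrix3P; rewrite mulmx3E !mx3E; ring.
  by apply: matrix3P; rewrite mulmx3E !mx3E; ring.
have solve (x y z : K) : (forall j, (j < 3)%N ->
    x + y * (-1) ^+ j + z * (- 2) ^+ j = 0) -> [/\ x = 0, y = 0 & z = 0].
  move=> e; apply: vandermonde3.
  - by rewrite -[RHS](e 0%N isT) !expr0; ring.
  - by rewrite -[RHS](e 1%N isT) !expr1; ring.
  - by rewrite -[RHS](e 2%N isT) !expr2; ring.
have [a0 a1 a2] := solve _ _ _ row0.
have [b0 b1 b2] := solve _ _ _ row1.
have [c0 c1 c2] := solve _ _ _ row2.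
by apply: matrix3P; rewrite ?(a0, a1, a2, b0, b1, b2, c0, c1, c2) mxE.
Qed.

Theorem restrict_inj : injective (@restrict R r).
Proof.
suff restrict0 (a : char_ring R r) : restrict a = 0 -> a = 0.
  move=> a b ab; apply/eqP; rewrite -subr_eq0; apply/eqP/restrict0.
  by rewrite raddfB /= ab subrr.
move=> a0; have /char_funP[a_reg a_inv] := valP a.
pose Q : {mpoly K[#|{: Defs.coord r}|]} :=
  \det (word_basis (generic_mx R k1) (generic_mx R k1 + generic_mx R k2)).
have QE (M : SL3r R r) : Q.@[coord_values M] =
    \det (word_basis (val (M k1)) (val (M k1) + val (M k2))).
  rewrite /Q -det_map_mx map_word_basis map_mxD.
  have genE k : map_mx (meval (coord_values M)) (generic_mx R k) = val (M k).
    by apply/matrixP => i j; rewrite mxE meval_generic.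
  by rewrite !genE.
pose N : SL3r R r := fun k => if k == k1
  then exist (fun A : 'M[K]_3 => \det A == 1) _ det_cyclic3
  else exist (fun A : 'M[K]_3 => \det A == 1) _ det_diag_sub_cyclic3.
apply: val_inj; apply: funext => M.
apply: (regular_eq0 (F := fun=> True) (Q := Q) (N := N)) => //.
  rewrite QE /N eqxx (_ : k2 == k1 = false) //=.
  rewrite (_ : _ + _ = dia 1 (-1) (- 2)); first exact: word_basis_cyclic_diag.
  by apply: matrix3P; rewrite mxE !mx3E; ring.
move=> L _; rewrite QE => /conj_normal_pair[g gL].
by rewrite -(a_inv g); apply: (restrict_normal_pair a0 gL).
Qed.

End Density.

(** * Derivations of the character ring *)

Section DirectionalDerivatives.
Variables (R : realType) (r : nat).
Local Notation K := R[i].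
Local Notation var := ('I_#|{: Defs.coord r}|).
Implicit Types (M : SL3r R r) (P Q : {mpoly K[#|{: Defs.coord r}|]}) (k : 'I_r).
Implicit Types (N U : 'M[K]_3).

Lemma deriv_derivation : derivation (fun p : {poly K} => p^`()).
Proof.
split=> [p q|c p|p q]; rewrite ?derivD ?derivZ ?derivM //.
by rewrite addrC [_ * q]mulrC.
Qed.

Lemma horner_aeval n (f : 'I_n -> {poly K}) S t :
  (aeval f S).[t] = S.@[fun i => (f i).[t]].
Proof.
elim/mpoly_ring_ind: S => [c|i|p q IHp IHq|p q IHp IHq].
- by rewrite aevalC mevalC hornerZ hornerC mulr1.
- by rewrite aevalX mevalXU.
- by rewrite aevalD hornerD mevalD IHp IHq.
- by rewrite aevalM hornerM mevalM IHp IHq.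
Qed.

Lemma polynomial_ext (p q : {poly K}) : (forall t, p.[t] = q.[t]) -> p = q.
Proof.
move=> pq; apply/eqP; rewrite -subr_eq0; apply/negPn/negP.
by move/closed_nonrootP => [t]; rewrite rootE hornerD hornerN pq subrr eqxx.
Qed.

(* The tangent vector at [M] of the curve that multiplies the [k]-th          *)
(* component on the right by [1 + t U].                                       *)
Definition tangent M k U (x : var) : K :=
  let: (l, i, j) := enum_val x in
  if l == k then (val (M k) *m U) i j else 0.

Definition dirder P M k U : K :=
  \sum_x P^`M(x).@[coord_values M] * tangent M k U x.

Lemma dirder_linear P M k c U U' :
  dirder P M k (c *: U + U') = c * dirder P M k U + dirder P M k U'.
Proof.
rewrite /dirder big_distrr -big_split; apply: eq_bigr => x _ /=.
rewrite mulrCA -mulrDr; congr (_ * _); rewrite /tangent.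
case: (enum_val x) => -[l i] j; case: eqP => _; last by rewrite mulr0 addr0.
by rewrite mulmxDr -scalemxAr !mxE.
Qed.

Definition unipotent N := N *m N = 0 /\ forall t, \det (1%:M + t *: N) = 1.

(* Traceless matrices are spanned by square-zero ones, along which SL3        *)
(* contains straight lines.                                                   *)
Lemma traceless_ind (psi : 'M[K]_3 -> K) U :
  (forall c V W, psi (c *: V + W) = c * psi V + psi W) ->
  (forall N, unipotent N -> psi N = 0) -> \tr U = 0 -> psi U = 0.
Proof.
move=> psi_lin psi_unip trU.
have psi0 : psi 0 = 0.
  by apply: psi_unip; split=> [|t]; rewrite ?mulmx0 ?scaler0 ?addr0 ?det1.
have step c N V : unipotent N -> psi V = 0 -> psi (c *: N + V) = 0.
  by move=> /psi_unip N0 V0; rewrite psi_lin N0 V0 mulr0 addr0.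
have U22 : U 2 2 = - U 0 0 - U 1 1.
  by move: trU; rewrite /mxtrace sum3 => /eqP; rewrite addr_eq0 => /eqP e;
    rewrite -[RHS]opprK opprD !opprK e opprK.
(* Two rank-one square-zero matrices carry the diagonal; the six elementary matrices correct the
   off-diagonal entries. *)
rewrite (_ : U =
  U 0 0 *: mx3 1 0 (-1) 0 0 0 1 0 (-1) + (U 1 1 *: mx3 0 0 0 0 1 (-1) 0 1 (-1) +
  (U 0 1 *: mx3 0 1 0 0 0 0 0 0 0 + (U 1 0 *: mx3 0 0 0 1 0 0 0 0 0 +
  ((U 0 2 + U 0 0) *: mx3 0 0 1 0 0 0 0 0 0 +
  ((U 2 0 - U 0 0) *: mx3 0 0 0 0 0 0 1 0 0 +
  ((U 1 2 + U 1 1) *: mx3 0 0 0 0 0 1 0 0 0 +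
  ((U 2 1 - U 1 1) *: mx3 0 0 0 0 0 0 0 1 0 + 0)))))))).
  do 8![apply: (step); first by split=> [|t];
    [apply: matrix3P; rewrite mulmx3E !mx3E mxE; ring
    |rewrite det3E !mxE /=; ring]].
  exact: psi0.
by apply: matrix3P; rewrite !mxE /= ?U22; ring.
Qed.

Lemma unipotent_conj (g N : 'M[K]_3) :
  g \in unitmx -> unipotent N -> unipotent (g *m N *m invmx g).
Proof.
move=> gu [NN detN]; split=> [|t].
  by rewrite !mulmxA mulmxKV // -[_ *m N *m N]mulmxA NN mulmx0 mul0mx.
have -> : 1%:M + t *: (g *m N *m invmx g) = g *m (1%:M + t *: N) *m invmx g.
  by rewrite mulmxDr mulmx1 mulmxDl mulmxV // -scalemxAr -scalemxAl.
by rewrite !det_mulmx detN mulr1 -det_mulmx mulmxV // det1.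
Qed.

Section Curve.
Variables (N : 'M[K]_3) (N_unip : unipotent N) (k : 'I_r).

Lemma det_translate M t l :
  \det (if l == k then val (M k) *m (1%:M + t *: N) else val (M l)) == 1.
Proof.
case: (l == k); last exact: valP (M l).
by rewrite det_mulmx N_unip.2 mulr1 (eqP (valP (M k))).
Qed.

Definition translate M t : SL3r R r :=
  fun l => exist (fun A : 'M[K]_3 => \det A == 1) _ (det_translate M t l).

Lemma translate_poly P M : exists q : {poly K},
  (forall t, q.[t] = P.@[coord_values (translate M t)]) /\
  q^`().[0] = dirder P M k N.
Proof.
pose u x := (coord_values M x)%:P + tangent M k N x *: 'X.
exists (aeval u P); split=> [t|].
  rewrite horner_aeval; apply: meval_eq => x.
  rewrite /u hornerD hornerC hornerZ hornerX /coord_values /tangent.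
  case: (enum_val x) => -[l i] j /=; case: eqP => [->|_].
    by rewrite mulmxDr mulmx1 -scalemxAr !mxE mulrC.
  by rewrite mul0r addr0.
rewrite (derivation_aeval deriv_derivation) horner_sum; apply: eq_bigr => x _.
rewrite hornerM horner_aeval /u derivD derivC derivZ derivX add0r alg_polyC hornerC.
congr (_ * _); apply: meval_eq => y.
by rewrite hornerD hornerC hornerZ hornerX mulr0 addr0.
Qed.

End Curve.

Lemma eq_dirder_unipotent P P' M M' k k' N N'
    (N_unip : unipotent N) (N'_unip : unipotent N') :
  (forall t, P.@[coord_values (translate N_unip k M t)] =
             P'.@[coord_values (translate N'_unip k' M' t)]) ->
  dirder P M k N = dirder P' M' k' N'.
Proof.
move=> PP'.
have [q [qE <-]] := translate_poly N_unip k P M.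
have [q' [q'E <-]] := translate_poly N'_unip k' P' M'.
suff -> : q = q' by [].
by apply: polynomial_ext => t; rewrite qE q'E.
Qed.

(** The derivative depends only on the function on SL3^r and not on the polynomial representing it:
    along a square-zero direction both polynomials are restricted to one line inside SL3^r. *)
Lemma eq_dirder P P' M k U : \tr U = 0 ->
  (forall L, P.@[coord_values L] = P'.@[coord_values L]) ->
  dirder P M k U = dirder P' M k U.
Proof.
move=> trU PP'; apply/eqP; rewrite -subr_eq0; apply/eqP.
apply: (traceless_ind (psi := fun V => dirder P M k V - dirder P' M k V)) trU.
  by move=> c V W; rewrite !dirder_linear mulrBr opprD addrACA.
move=> N N_unip; apply/eqP; rewrite subr_eq0; apply/eqP.
by apply: (eq_dirder_unipotent (N_unip := N_unip) (N'_unip := N_unip)) => t.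
Qed.

Lemma dirder_conj P M k U (g : SL3 R) : \tr U = 0 ->
  (forall L, P.@[coord_values (fun l => SL3_conj g (L l))] = P.@[coord_values L]) ->
  dirder P (fun l => SL3_conj g (M l)) k (val g *m U *m invmx (val g)) =
  dirder P M k U.
Proof.
move=> trU P_inv; apply/eqP; rewrite -subr_eq0; apply/eqP.
have gu := SL3_unit g.
apply: (traceless_ind (psi := fun V =>
  dirder P (fun l => SL3_conj g (M l)) k (val g *m V *m invmx (val g)) -
  dirder P M k V)) trU.
  move=> c V W; rewrite mulmxDr mulmxDl -scalemxAr -scalemxAl !dirder_linear.
  by rewrite mulrBr opprD addrACA.
move=> N N_unip; apply/eqP; rewrite subr_eq0; apply/eqP.
apply: (eq_dirder_unipotent (N_unip := unipotent_conj gu N_unip)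
  (N'_unip := N_unip)) => t.
rewrite -[RHS]P_inv; congr (P.@[coord_values _]); apply: funext => l; apply: val_inj.
rewrite /=; case: eqP => // _.
rewrite !mulmxDr !mulmx1 mulmxDl; congr (_ + _).
by rewrite -!scalemxAr -scalemxAl !mulmxA mulmxKV.
Qed.

Lemma dirderD P Q M k U :
  dirder (P + Q) M k U = dirder P M k U + dirder Q M k U.
Proof.
rewrite /dirder -big_split; apply: eq_bigr => x _ /=.
by rewrite mderivD mevalD mulrDl.
Qed.

Lemma dirderZ c P M k U : dirder (c *: P) M k U = c * dirder P M k U.
Proof.
rewrite /dirder big_distrr; apply: eq_bigr => x _ /=.
by rewrite mderivZ mevalZ mulrA.
Qed.

Lemma dirderM P Q M k U : dirder (P * Q) M k U =
  P.@[coord_values M] * dirder Q M k U + Q.@[coord_values M] * dirder P M k U.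
Proof.
rewrite /dirder !big_distrr -big_split; apply: eq_bigr => x _ /=.
by rewrite mderivM mevalD !mevalM; ring.
Qed.

(** Product rule for the word when M_k becomes M_k (1 + t U); to first order its inverse becomes (1
    - t U) M_k^-1. *)
Fixpoint dword M k U (w : word r) : 'M[K]_3 :=
  if w is (l, b) :: w' then
    (if l != k then 0 else
     if b then - (U *m invmx (val (M l))) else val (M l) *m U) *m word_eval M w' +
    (if b then invmx (val (M l)) else val (M l)) *m dword M k U w'
  else 0.

Lemma dword_linear M k w c U U' :
  dword M k (c *: U + U') w = c *: dword M k U w + dword M k U' w.
Proof.
elim: w => [|[l b] w IH] /=; first by rewrite scaler0 addr0.
rewrite IH; set W := word_eval M w; set V := (if b then _ else val _).
rewrite [in RHS]scalerDr [in RHS]addrACA.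
congr (_ + _); last by rewrite mulmxDr -scalemxAr.
rewrite scalemxAl -mulmxDl; congr (_ *m _).
case: (l != k); first by rewrite scaler0 addr0.
case: b {V}; last by rewrite mulmxDr -scalemxAr.
by rewrite mulmxDl -scalemxAl scalerN opprD.
Qed.

Lemma dirder_trace_unipotent P M k N (w : word r) : unipotent N ->
  (forall L, P.@[coord_values L] = \tr (word_eval L w)) ->
  dirder P M k N = \tr (dword M k N w).
Proof.
move=> N_unip PE; have [q [qE <-]] := translate_poly N_unip k P M.
suff [W [WE dWE]] : exists W : 'M[{poly K}]_3,
    (forall t i j, (W i j).[t] = word_eval (translate N_unip k M t) w i j) /\
    (forall i j, (W i j)^`().[0] = dword M k N w i j).
  have -> : q = \tr W.
    apply: polynomial_ext => t; rewrite qE PE /mxtrace horner_sum.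
    by apply: eq_bigr => i _; rewrite WE.
  rewrite /mxtrace (big_morph deriv (@derivD K) (@deriv0 K)) horner_sum.
  by apply: eq_bigr => i _; rewrite dWE.
elim: w {q qE PE} => [|[l b] w [W [WE dWE]]].
  exists 1%:M; split=> [t i j|i j]; rewrite ?/word_eval ?big_nil !mxE.
    by rewrite -polyCMn hornerC.
  by rewrite -polyCMn derivC hornerC.
pose L0 : 'M[K]_3 := if b then invmx (val (M l)) else val (M l).
pose L1 : 'M[K]_3 := if l != k then 0 else
     if b then - (N *m invmx (val (M l))) else val (M l) *m N.
pose L : 'M[{poly K}]_3 := \matrix_(i, j) ((L0 i j)%:P + L1 i j *: 'X).
have LE t : (if b then invmx (val (translate N_unip k M t l))
             else val (translate N_unip k M t l)) = L0 + t *: L1.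
  rewrite /L0 /L1 /=; have [->|_] /= := eqVneq l k; last by rewrite scaler0 addr0.
  case: (b); last by rewrite mulmxDr mulmx1 scalemxAr.
  have Mu := SL3_unit (M k); set A := val (M k) in Mu *.
  (* Since N^2 = 0, the inverse is exactly affine in t, and inverse letters also have polynomial
     entries. *)
  have NV : (1%:M + t *: N) *m (1%:M - t *: N) = 1%:M.
    rewrite mulmxDl !mulmxBr !mulmx1 !mul1mx -scalemxAl -scalemxAr N_unip.1.
    by rewrite !scaler0 subr0 subrK.
  have AV : A *m (1%:M + t *: N) *m ((1%:M - t *: N) *m invmx A) = 1%:M.
    by rewrite mulmxA -[A *m _ *m _]mulmxA NV mulmx1 mulmxV.
  have [AN_u _] := mulmx1_unit AV.
  rewrite -[LHS]mulmx1 -[X in _ *m X = _]AV mulKmx // mulmxBl mul1mx.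
  by rewrite scalerN -scalemxAl.
exists (L *m W); split=> [t i j|i j].
  rewrite /word_eval big_cons -mulmxE LE !mxE horner_sum.
  apply: eq_bigr => x _; rewrite hornerM WE; congr (_ * _).
  by rewrite [in LHS]mxE !hornerE [RHS]mxE [X in _ = _ + X]mxE mulrC.
rewrite mxE (big_morph deriv (@derivD K) (@deriv0 K)) horner_sum /= !mxE -big_split.
apply: eq_bigr => x _ /=; rewrite derivM hornerD !hornerM WE dWE !mxE.
rewrite derivD derivC derivZ derivX add0r !hornerE.
rewrite (_ : translate N_unip k M 0 = M) //.
apply: funext => y; apply: val_inj; rewrite /=.
by case: eqP => // ->; rewrite scale0r addr0 mulmx1.
Qed.

Lemma dirder_trace P M k U (w : word r) : \tr U = 0 ->
  (forall L, P.@[coord_values L] = \tr (word_eval L w)) ->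
  dirder P M k U = \tr (dword M k U w).
Proof.
move=> trU PE; apply/eqP; rewrite -subr_eq0; apply/eqP.
apply: (traceless_ind (psi := fun V => dirder P M k V - \tr (dword M k V w))) trU.
  move=> c V W; rewrite dirder_linear dword_linear mxtraceD mxtraceZ.
  by rewrite mulrBr opprD addrACA.
by move=> N N_unip; rewrite (dirder_trace_unipotent M k N_unip PE) subrr.
Qed.

End DirectionalDerivatives.

(** * Derivations along equivariant directions *)

Section EquivariantDerivations.
Variables (R : realType) (r : nat).
Local Notation K := R[i].
Variables (k : 'I_r) (w : seq 'I_r).

(* [direction] is an SL3-equivariant map to traceless matrices, so that       *)
(* differentiating along it preserves invariant functions.                    *)
Definition direction (M : SL3r R r) : 'M[K]_3 :=
  let W := \prod_(l <- w) val (M l) in 3 *: W - (\tr W)%:M.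

Lemma trace_direction M : \tr (direction M) = 0.
Proof.
by rewrite /direction linearB /= mxtraceZ mxtrace_scalar mulr_natl subrr.
Qed.

Lemma direction_conj (g : SL3 R) M :
  direction (fun l => SL3_conj g (M l)) =
  val g *m direction M *m invmx (val g).
Proof.
have gu := SL3_unit g.
have WE : \prod_(l <- w) val (SL3_conj g (M l)) =
    val g *m (\prod_(l <- w) val (M l)) *m invmx (val g).
  elim: (w) => [|l u IH]; first by rewrite !big_nil mulmx1 mulmxV.
  by rewrite !big_cons IH /= -!mulmxE !mulmxA mulmxKV.
rewrite /direction WE mulmxBr mulmxBl -scalemxAr -scalemxAl.
rewrite [in LHS]mxtrace_mulC mulmxA mulVmx // mul1mx.
by rewrite scalar_mxC; congr (_ - _); rewrite -mulmxA mulmxV ?mulmx1.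
Qed.

Definition lift_poly (a : char_ring R r) : {mpoly K[#|{: Defs.coord r}|]} :=
  sval (cid (elimT (char_funP _) (valP a)).1).

Lemma lift_polyE a (M : SL3r R r) : (lift_poly a).@[coord_values M] = a M.
Proof. by rewrite /lift_poly; case: cid => P /= ->. Qed.

Definition derive_fun (a : char_ring R r) (M : SL3r R r) : K^o :=
  dirder (lift_poly a) M k (direction M).

(** Invariance combines [dirder_conj] with the equivariance of [direction]; regularity follows by
    writing the same formula with generic matrices. *)
Lemma derive_fun_char a : derive_fun a \in @char_fun R r.
Proof.
apply/char_funP; split; last first.
  move=> g M; rewrite /derive_fun direction_conj dirder_conj ?trace_direction //.
  move=> L; rewrite !lift_polyE.
  by have /char_funP[_ a_inv] := valP a; apply: a_inv.
pose GW := \prod_(l <- w) generic_mx R l.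
pose GU := generic_mx R k *m (3 *: GW - (\tr GW)%:M).
exists (\sum_x (lift_poly a)^`M(x) *
  let: (l, i, j) := enum_val x in if l == k then GU i j else 0) => M.
rewrite (big_morph (meval (coord_values M)) (mevalD _) (meval0 _)).
have genE l : map_mx (meval (coord_values M)) (generic_mx R l) = val (M l).
  by apply/matrixP => i j; rewrite mxE meval_generic.
have GUE : map_mx (meval (coord_values M)) GU = val (M k) *m direction M.
  rewrite map_mxM genE map_mxB map_mxZ map_scalar_mx /= -trace_map_mx.
  have -> : map_mx (meval (coord_values M)) GW = \prod_(l <- w) val (M l).
    by rewrite rmorph_prod; apply: eq_bigr => l _; rewrite /= genE.
  by rewrite rmorph_nat.
apply: eq_bigr => x _; rewrite mevalM; congr (_ * _).
rewrite /tangent; case: (enum_val x) => -[l i] j; case: eqP => _.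
  by rewrite -GUE mxE.
by rewrite meval0.
Qed.

Definition derive_char (a : char_ring R r) : char_ring R r :=
  CharRing (derive_fun_char a).

Lemma derive_charE (a : char_ring R r) P M : (forall L, P.@[coord_values L] = a L) ->
  derive_char a M = dirder P M k (direction M).
Proof.
move=> Pa; apply: eq_dirder; first exact: trace_direction.
by move=> L; rewrite lift_polyE Pa.
Qed.

Lemma derive_char_derivation : derivation derive_char.
Proof.
split=> [a b|c a|a b]; apply: val_inj; apply: funext => M.
- transitivity (dirder (lift_poly a + lift_poly b) M k (direction M)).
    by apply: derive_charE => L; rewrite mevalD !lift_polyE.
  exact: dirderD.
- transitivity (dirder (c *: lift_poly a) M k (direction M)).
    by apply: derive_charE => L; rewrite mevalZ lift_polyE.
  exact: dirderZ.
- transitivity (dirder (lift_poly a * lift_poly b) M k (direction M)).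
    by apply: derive_charE => L; rewrite mevalM !lift_polyE.
  by rewrite dirderM !lift_polyE.
Qed.

Lemma derive_char_trace (u : word r) M :
  derive_char (tr R u) M = \tr (dword M k (direction M) u).
Proof.
by apply: dirder_trace; [exact: trace_direction | move=> L; exact: lift_polyE].
Qed.

End EquivariantDerivations.

Arguments derive_char : simpl never.

(** * The Jacobian at an integer point *)

Section IntegerMatrices.
Local Open Scope ring_scope.
Notation table := (seq (seq int)).

(** Tables of integers mirror the matrix calculus in a form that can be evaluated by computation. *)
Definition entry (L : table) (i j : nat) : int := nth 0 (nth [::] L i) j.

Definition tabulate3 (f : nat -> nat -> int) : table :=
  [seq [seq f i j | j <- iota 0 3] | i <- iota 0 3].

Definition tmul (L L' : table) : table := tabulate3 (fun i j =>
  entry L i 0 * entry L' 0 j + entry L i 1 * entry L' 1 j +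
  entry L i 2 * entry L' 2 j).

Definition tadd (L L' : table) := tabulate3 (fun i j => entry L i j + entry L' i j).

Definition topp (L : table) := tabulate3 (fun i j => - entry L i j).

Definition tscalar (a : int) := tabulate3 (fun i j => if i == j then a else 0).

Definition ttrace (L : table) : int := entry L 0 0 + entry L 1 1 + entry L 2 2.

(* The integer point at which the Jacobian determinant is evaluated: all the  *)
(* components from the third on are equal. The boolean marks an inverse.      *)
Definition tletter (l : nat * bool) : table :=
  match l with
  | (0%N, false) => [:: [:: 0; 0; 1]; [:: 0; -1; 0]; [:: 1; -1; 0]]
  | (0%N, true) => [:: [:: 0; -1; 1]; [:: 0; -1; 0]; [:: 1; 0; 0]]
  | (1%N, false) => [:: [:: 0; 0; -1]; [:: 0; -1; 1]; [:: -1; 0; 0]]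
  | (1%N, true) => [:: [:: 0; 0; -1]; [:: -1; -1; 0]; [:: -1; 0; 0]]
  | (_, false) => [:: [:: 0; 1; -1]; [:: 1; 0; 1]; [:: 1; 0; 0]]
  | (_, true) => [:: [:: 0; 0; 1]; [:: 1; 1; -1]; [:: 0; 1; -1]]
  end.

Definition tword (u : seq (nat * bool)) : table :=
  foldr (fun l => tmul (tletter l)) (tscalar 1) u.

Definition tdirection (w : seq nat) : table :=
  let W := tword [seq (s, false) | s <- w] in
  tadd (tmul (tscalar 3) W) (topp (tscalar (ttrace W))).

Fixpoint tdword (k : nat) (U : table) (u : seq (nat * bool)) : table :=
  if u is (s, b) :: u' then
    tadd (tmul (if s != k then tscalar 0 else
                if b then topp (tmul U (tletter (s, true)))
                else tmul (tletter (s, false)) U) (tword u'))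
         (tmul (tletter (s, b)) (tdword k U u'))
  else tscalar 0.

Definition tderive (d : nat * seq nat) (u : seq (nat * bool)) : int :=
  ttrace (tdword d.1 (tdirection d.2) u).

(** The symbols 0 and 1 denote the first two components, and 2 the later component to which a block
    belongs. *)
Definition pair_words : seq (seq (nat * bool)) :=
  [:: [:: (0, false)]; [:: (1, false)]; [:: (0, true)]; [:: (1, true)];
      [:: (0, false); (1, false)]; [:: (0, true); (1, false)];
      [:: (1, true); (0, false)]; [:: (0, true); (1, true)]]%N.

(** A pair (k, w) encodes the derivation that moves component k along the traceless part of the word
    w. *)
Definition pair_directions : seq (nat * seq nat) :=
  [:: (0, [:: 0]); (1, [:: 0]); (0, [:: 1]); (1, [:: 1]);
      (0, [:: 0; 0]); (1, [:: 0; 0]); (0, [:: 0; 1]); (1, [:: 0; 1])]%N.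

Definition common_words : seq (seq (nat * bool)) :=
  [:: [:: (2, false)]; [:: (2, true)]; [:: (0, false); (2, false)];
      [:: (1, false); (2, false)]; [:: (0, false); (2, true)]]%N.

Definition case_words : seq (seq (seq (nat * bool))) :=
  [:: [:: [:: (0, true); (2, true)]; [:: (0, true); (2, false)]; [:: (1, true); (2, true)]];
      [:: [:: (0, true); (2, true)]; [:: (0, true); (2, false)]; [:: (1, true); (2, false)]];
      [:: [:: (0, true); (2, true)]; [:: (0, true); (2, false)]; [:: (1, false); (2, true)]];
      [:: [:: (0, true); (2, false)]; [:: (1, true); (2, false)]; [:: (1, false); (2, true)]];
      [:: [:: (0, true); (2, true)]; [:: (1, false); (2, true)]; [:: (1, true); (2, true)]]]%N.

Definition block_words (cs b : nat) :=
  if b == 0%N then pair_words else common_words ++ nth [::] case_words cs.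

Definition block_directions (b : nat) : seq (nat * seq nat) :=
  if b == 0%N then pair_directions else
  [seq (2, w) | w <- [:: [:: 0]; [:: 1]; [:: 0; 0]; [:: 0; 1]; [:: 1; 0];
                         [:: 1; 1]; [:: 0; 0; 1]; [:: 0; 1; 1]]]%N.

Definition block_entry cs b (c d : nat) : int :=
  tderive (nth (0, [::])%N (block_directions b) d) (nth [::] (block_words cs b) c).

(* Integer multiples of the inverses of the diagonal blocks of the Jacobian.  *)
Definition pair_inverse : table :=
  [:: [:: -12; -27; -30; -45; -27; -18; -27; -36];
      [:: 22; -33; 0; -65; -3; -47; -63; -19];
      [:: -19; -24; -30; -40; -24; -16; -24; -32];
      [:: 15; -30; 0; -60; 0; -30; -45; -15];
      [:: 22; -18; 15; -35; -18; -17; -33; -19];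
      [:: 26; 6; 0; -25; -9; -61; -69; -17];
      [:: -4; -24; -15; -40; -24; -16; -24; -32];
      [:: 22; -18; 0; -50; -3; -47; -63; -19]].

Definition case_inverse : seq table :=
  [:: [:: [:: 0; 14; 17; -4; 8; 5; -14; -6];
          [:: 4; -16; -12; -8; -8; -8; 8; -8];
          [:: 0; 12; 14; 4; 8; 2; -12; 4];
          [:: 0; 0; 4; 0; 0; 0; -4; 0];
          [:: 4; -2; 1; 0; 0; -3; -2; -2];
          [:: 4; -14; -11; -4; -8; -7; 6; -6];
          [:: 0; 6; 9; 8; 4; 1; -6; 6];
          [:: 0; -10; -9; 0; -4; -5; 6; 2]];
      [:: [:: -6; 16; 10; -2; 10; 4; -10; -6];
          [:: -6; 4; -4; -4; 4; -2; 0; -8];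
          [:: 4; 0; 6; 2; 0; 0; -4; 4];
          [:: 0; 0; 2; 0; 0; 0; -2; 0];
          [:: 0; 2; 1; 0; 2; -1; -2; -2];
          [:: -4; 2; -4; -2; 2; -2; 0; -6];
          [:: 6; -6; 3; 4; -4; -1; 0; 6];
          [:: 2; -8; -5; 0; -4; -3; 4; 2]];
      [:: [:: 0; 24; 33; 0; 12; 9; -24; -6];
          [:: 6; -20; -8; -4; -12; -10; 8; -8];
          [:: 0; 16; 16; 2; 12; 2; -16; 4];
          [:: 0; 0; 6; 0; 0; 0; -6; 0];
          [:: 6; -2; 4; 2; 0; -4; -4; -2];
          [:: 6; -18; -9; 0; -12; -9; 6; -6];
          [:: 0; 6; 6; 6; 6; 0; -6; 6];
          [:: 0; -16; -16; -2; -6; -8; 10; 2]];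
      [:: [:: 9; -8; 7; 3; -7; -1; 9; -4];
          [:: -9; 10; -3; -4; 8; -2; -10; 2];
          [:: 2; 0; 3; 1; 0; -2; 2; 0];
          [:: 0; 0; 1; 0; 0; -1; 0; 0];
          [:: -3; 5; 0; -1; 4; -2; -4; 1];
          [:: -8; 9; -3; -3; 7; -2; -9; 2];
          [:: 0; 1; 1; 1; 1; -1; 0; 1];
          [:: -8; 8; -4; -3; 7; -1; -8; 3]];
      [:: [:: 0; 0; -9; -16; 4; -1; 14; -24];
          [:: 2; -4; 4; 4; -4; -2; -8; 8];
          [:: 0; 0; -8; -10; 4; -2; 12; -16];
          [:: 0; -2; -3; -4; 0; -1; 4; -6];
          [:: 2; -2; -2; -2; 0; -2; 2; -4];
          [:: 2; -4; 2; 4; -4; -2; -6; 6];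
          [:: 0; 0; -3; -2; 2; -1; 6; -6];
          [:: 0; -2; 3; 6; -2; -1; -6; 10]]].

Definition block_inverse cs b : table :=
  if b == 0%N then pair_inverse else nth [::] case_inverse cs.

Definition block_multiple (cs b : nat) : int :=
  if b == 0%N then 45 else nth 0 [:: 12; 6; 18; 3; 6] cs.

Definition block_check cs b : bool :=
  all (fun c => all (fun d =>
    foldr +%R 0 [seq entry (block_inverse cs b) c e * block_entry cs b e d | e <- iota 0 8]
    == if c == d then block_multiple cs b else 0) (iota 0 8)) (iota 0 8).

(** Two blocks per case suffice: the integer point has equal components from the third on, so all
    later blocks coincide. *)
Lemma block_checkP : all (fun cs => block_check cs 0 && block_check cs 1) (iota 0 5).
Proof. by vm_compute. Qed.

End IntegerMatrices.

Arguments tletter : simpl never.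

(** * From integer tables to the Jacobian on the character ring *)

Section IntegerPoint.
Variables (R : realType) (r : nat) (r_ge2 : (2 <= r)%N).
Local Notation K := R[i].
Local Notation k1 := (i1 r_ge2).
Local Notation k2 := (i2 r_ge2).

Definition of_table (L : seq (seq int)) : 'M[K]_3 :=
  \matrix_(i, j) (entry L i j)%:~R.

Lemma entry_tabulate3 f (i j : 'I_3) : entry (tabulate3 f) i j = f i j.
Proof. by case: i j => -[|[|[|//]]] ? [[|[|[|//]]] ?]. Qed.

Lemma of_tmul L L' : of_table (tmul L L') = of_table L *m of_table L'.
Proof.
apply/matrixP => i j; rewrite mulmx3E !mxE entry_tabulate3.
by rewrite !rmorphD !rmorphM.
Qed.

Lemma of_tadd L L' : of_table (tadd L L') = of_table L + of_table L'.
Proof. by apply/matrixP => i j; rewrite !mxE entry_tabulate3 rmorphD. Qed.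

Lemma of_topp L : of_table (topp L) = - of_table L.
Proof. by apply/matrixP => i j; rewrite !mxE entry_tabulate3 rmorphN. Qed.

Lemma of_tscalar a : of_table (tscalar a) = (a%:~R)%:M.
Proof.
apply/matrixP => i j; rewrite !mxE entry_tabulate3 -val_eqE /=.
by case: eqP; rewrite ?mulr1n ?mulr0n.
Qed.

Lemma of_ttrace L : \tr (of_table L) = (ttrace L)%:~R.
Proof. by rewrite /mxtrace sum3 !mxE /ttrace !rmorphD. Qed.

Lemma det_tletter s : \det (of_table (tletter (s, false))) == 1.
Proof.
by apply/eqP; rewrite det3E !mxE; case: s => [|[|s]]; rewrite /entry /=; ring.
Qed.

Definition integer_point : SL3r R r := fun l =>
  exist (fun A : 'M[K]_3 => \det A == 1) _ (det_tletter l).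

Lemma integer_pointV l :
  invmx (val (integer_point l)) = of_table (tletter (l : nat, true)).
Proof.
have lV : val (integer_point l) *m of_table (tletter (l : nat, true)) = 1%:M.
  rewrite /= -of_tmul (_ : tmul _ _ = tscalar 1) ?of_tscalar //.
  by case: (l : nat) => [|[|?]].
have [lu _] := mulmx1_unit lV.
by rewrite -[LHS]mulmx1 -lV mulKmx.
Qed.

Section Block.
Variable k : 'I_r.

Definition index3 (s : nat) : 'I_r :=
  if s == 0%N then k1 else if s == 1%N then k2 else k.

Variable bound : nat.
Hypothesis index3_inj : forall s s', (s < bound)%N -> (s' < bound)%N ->
  (index3 s == index3 s') = (s == s').
Hypothesis index3_letter : forall s b, (s < bound)%N ->
  tletter (index3 s : nat, b) = tletter (s, b).

Definition index3_word (u : seq (nat * bool)) : word r :=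
  [seq (index3 l.1, l.2) | l <- u].

Lemma word_eval_table u : all (fun l => l.1 < bound)%N u ->
  word_eval integer_point (index3_word u) = of_table (tword u).
Proof.
elim: u => [|[s b] u IH] /=; first by rewrite /word_eval big_nil of_tscalar.
move=> /andP[sb /IH uE]; rewrite of_tmul -uE /word_eval big_cons -mulmxE.
congr (_ *m _); rewrite -(index3_letter b sb).
by case: b => //; exact: integer_pointV.
Qed.

Lemma direction_table w : all (fun s => s < bound)%N w ->
  direction (map index3 w) integer_point = of_table (tdirection w).
Proof.
move=> wb; rewrite /direction /tdirection of_tadd of_topp of_tmul !of_tscalar.
have -> : \prod_(l <- map index3 w) val (integer_point l) =
    of_table (tword [seq (s, false) | s <- w]).
  rewrite -word_eval_table ?all_map //.
  by rewrite /word_eval /index3_word -map_comp !big_map.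
by rewrite of_ttrace mul_scalar_mx.
Qed.

Lemma dword_table s U u : (s < bound)%N -> all (fun l => l.1 < bound)%N u ->
  dword integer_point (index3 s) (of_table U) (index3_word u) =
  of_table (tdword s U u).
Proof.
move=> sb; elim: u => [|[s' b] u IH] /=.
  by move=> _; rewrite of_tscalar -scalemx1 scale0r.
move=> /andP[s'b ub]; rewrite of_tadd !of_tmul -IH // word_eval_table //.
rewrite index3_inj //; congr (_ + _); congr (_ *m _).
  case: (s' != s); first by rewrite of_tscalar -scalemx1 scale0r.
  rewrite -!(index3_letter _ s'b); case: b; rewrite ?of_topp of_tmul //.
  by congr (- (_ *m _)); exact: (integer_pointV (index3 s')).
rewrite -(index3_letter b s'b).
by case: b => //; exact: (integer_pointV (index3 s')).
Qed.

Lemma derive_char_table s w u : (s < bound)%N ->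
  all (fun s => s < bound)%N w -> all (fun l => l.1 < bound)%N u ->
  derive_char (index3 s) (map index3 w) (tr R (index3_word u)) integer_point =
  (tderive (s, w) u)%:~R.
Proof.
by move=> sb wb ub; rewrite derive_char_trace direction_table // dword_table // of_ttrace.
Qed.

End Block.

Lemma dword_eq0 (M : SL3r R r) k U (u : word r) :
  all (fun l => l.1 != k) u -> dword M k U u = 0.
Proof.
elim: u => [|[l b] u IH] //= /andP[-> /IH ->].
by rewrite mul0mx mulmx0 addr0.
Qed.

Section Family.
Variable cs : nat.
Hypothesis cs_lt5 : (cs < 5)%N.
Local Notation N := #|{: 'I_r.-1 * 'I_8}|.

Lemma later_proof (b : 'I_r.-1) : (b.+1 < r)%N.
Proof. by rewrite -ltn_predRL ltn_ord. Qed.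

Definition later b : 'I_r := Ordinal (later_proof b).

Definition block_fun (b : 'I_r.-1) (c : nat) : char_ring R r :=
  tr R (index3_word (later b) (nth [::] (block_words cs b) c)).

Definition block_derive (b : 'I_r.-1) (c : nat) : char_ring R r -> char_ring R r :=
  derive_char (index3 (later b) (nth (0%N, [::]) (block_directions b) c).1)
    (map (index3 (later b)) (nth (0%N, [::]) (block_directions b) c).2).

Definition family (i : 'I_N) : char_ring R r :=
  let: (b, c) := enum_val i in block_fun b c.

Definition family_derive (i : 'I_N) : char_ring R r -> char_ring R r :=
  let: (b, c) := enum_val i in block_derive b c.

(** In block 0 the symbol 2 is excluded: there [later b] is the second component itself, and
    [index3] is injective only below 2. *)
Definition block_bound (b : nat) := if b == 0%N then 2%N else 3%N.

Lemma block_words_bound b c :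
  all (fun l => l.1 < block_bound b)%N (nth [::] (block_words cs b) c).
Proof.
rewrite /block_bound /block_words; case: eqP => _.
  by do 8?[case: c => [//|c]]; rewrite /= nth_nil.
move: cs_lt5; case: cs => [|[|[|[|[|//]]]]] _;
by do 8?[case: c => [//|c]]; rewrite /= nth_nil.
Qed.

Lemma block_directions_bound b c : (c < 8)%N ->
  let d := nth (0%N, [::]) (block_directions b) c in
  [&& d.1 < block_bound b, all (fun s => s < block_bound b)%N d.2
    & (b != 0) ==> (d.1 == 2)]%N.
Proof.
rewrite /block_bound /block_directions; case: eqP => _ /=;
by do 8?[case: c => [//|c]].
Qed.

Lemma index3_inj_block (b : 'I_r.-1) s s' :
  (s < block_bound b)%N -> (s' < block_bound b)%N ->
  (index3 (later b) s == index3 (later b) s') = (s == s').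
Proof.
case: s s' => [|[|[|s]]] [|[|[|s']]]; rewrite /block_bound /index3 -val_eqE /=;
by case: (b : nat) => [|b0]; rewrite ?eqxx.
Qed.

Lemma index3_letter_block (b : 'I_r.-1) s f : (s < block_bound b)%N ->
  tletter (index3 (later b) s : nat, f) = tletter (s, f).
Proof.
rewrite /block_bound /index3 /=.
by case: s => [|[|[|//]]] //=; case: (b : nat) => [|b'].
Qed.

Lemma jacobian_diag (b : 'I_r.-1) c d : (d < 8)%N ->
  block_derive b d (block_fun b c) integer_point = (block_entry cs b c d)%:~R.
Proof.
move=> d8; have /and3P[d1 d2 _] := block_directions_bound b d8.
rewrite /block_derive /block_fun /block_entry.
rewrite (derive_char_table (@index3_inj_block b) (@index3_letter_block b)) //.
exact: block_words_bound.
Qed.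

(** The derivations of a block b' > 0 move only the component [later b'], which does not occur in
    the words of another block. *)
Lemma jacobian_upper (b b' : 'I_r.-1) c d : (d < 8)%N -> b' != b -> b' != 0%N :> nat ->
  block_derive b' d (block_fun b c) integer_point = 0.
Proof.
move=> d8 bb' b'0; have /and3P[_ _] := block_directions_bound b' d8.
rewrite b'0 implyTb => /eqP d1; rewrite /block_derive /block_fun derive_char_trace d1.
rewrite dword_eq0 ?mxtrace0 // all_map; apply: sub_all (block_words_bound b c).
move=> [s f] /=; rewrite /index3 -val_eqE /=.
move: bb'; rewrite -val_eqE /=; case: s => [|[|s]] /=; lia.
Qed.

(* The Jacobian matrix at the integer point is block lower triangular.        *)
Lemma jacobian_family :
  \det (\matrix_(i, j) family_derive j (family i)) <> 0.
Proof.
pose ev (a : char_ring R r) : K := a integer_point.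
pose J := \matrix_(i, j) ev (family_derive j (family i)).
move=> detJ0; have detJ : \det J = 0.
  rewrite -[RHS](_ : ev 0 = 0) // -detJ0 /determinant.
  have evD : {morph ev : a b / a + b} by [].
  have evM : {morph ev : a b / a * b} by [].
  rewrite (big_morph ev evD (erefl : ev 0 = 0)); apply: eq_bigr => s _.
  have evX a n : ev (a ^+ n) = ev a ^+ n.
    by elim: n => [|n IH]; rewrite ?expr0 // !exprS evM IH.
  rewrite evM evX (big_morph ev evM (erefl : ev 1 = 1)); congr (_ * _).
  by apply: eq_bigr => i _; rewrite !mxE.
(* x is a combination of the derivations that kills every member of the family at the integer
   point. *)
have /eqP/det0P[x x0 xJ] : \det J^T = 0 by rewrite det_tr.
pose X (b : 'I_r.-1) (c : 'I_8) := x 0 (enum_rank (b, c)) : K.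
case/eqP: x0; apply/rowP => l; rewrite mxE -[l]enum_valK.
case: (enum_val l) => b c; rewrite -/(X b c).
pose jv b' (c' : 'I_8) b (c : 'I_8) : K :=
  block_derive b' c' (block_fun b c) integer_point.
have JX b' (c' : 'I_8) : \sum_b'' \sum_c'' X b'' c'' *
    jv b'' c'' b' c' = 0.
  have /rowP/(_ (enum_rank (b', c'))) := xJ; rewrite !mxE => e.
  rewrite -[RHS]e pair_big /= (reindex _ (onW_bij _ (@enum_rank_bij _))) /=.
  apply: eq_bigr => -[b'' c''] _; rewrite !mxE /family /family_derive.
  by rewrite !enum_rankK.
have diag b' : (forall c' : 'I_8, \sum_c'' X b' c'' *
    jv b' c'' b' c' = 0) ->
    forall c', X b' c' = 0.
  (* Every later block has the entries of block 1, the one that was checked. *)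
  move=> XJ c'; pose bb := if (b' : nat) == 0%N then 0%N else 1%N.
  have entryE e d : block_entry cs b' e d = block_entry cs bb e d.
    by rewrite /bb; case: (b' : nat).
  have : block_check cs bb.
    have /allP/(_ cs) := block_checkP; rewrite mem_iota cs_lt5 => /(_ isT)/andP[].
    by rewrite /bb; case: eqP.
  move=> /allP check; set m := block_multiple cs bb in check.
  have m0 : (m%:~R : K) != 0.
    rewrite intr_eq0 /m /bb; move: cs_lt5; case: (b' : nat) => [|?] //=.
    by case: cs => [|[|[|[|[|//]]]]].
  have inverseE (p q : 'I_8) : \sum_(e < 8)
      (entry (block_inverse cs bb) p e)%:~R * (block_entry cs bb e q)%:~R =
      if p == q then m%:~R else 0 :> K.
    have /check/allP/(_ q) : (p : nat) \in iota 0 8 by rewrite mem_iota ltn_ord.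
    rewrite mem_iota add0n ltn_ord => /(_ isT)/eqP.
    rewrite foldrE big_map -[iota 0 8]/(index_iota 0 8) big_mkord => pq.
    transitivity ((if (p : nat) == q then m else 0)%:~R : K); last by rewrite -val_eqE /=; case: (_ == _).
    rewrite -pq rmorph_sum; apply: eq_bigr => e _; exact/esym/rmorphM.
  apply: (mulIf m0); rewrite mul0r.
  transitivity (\sum_(e < 8) (entry (block_inverse cs bb) c' e)%:~R *
      \sum_(d < 8) X b' d * jv b' d b' e).
    transitivity (\sum_(d < 8) X b' d * \sum_(e < 8)
        (entry (block_inverse cs bb) c' e)%:~R * (block_entry cs bb e d)%:~R).
      rewrite (bigD1 c') //= inverseE eqxx big1 ?addr0 // => d dc'.
      by rewrite inverseE eq_sym (negPf dc') mulr0.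
    under eq_bigr do rewrite big_distrr.
    rewrite exchange_big; apply: eq_bigr => e _; rewrite big_distrr.
    apply: eq_bigr => d _; rewrite /jv jacobian_diag // entryE.
    by rewrite /= mulrCA.
  by rewrite big1 // => e _; rewrite XJ mulr0.
have r1 : (0 < r.-1)%N by case: (r) r_ge2 => [|[]].
(* Block 0 comes first: the other derivations kill its traces. With these coefficients gone, every
   other diagonal block stands alone. *)
have X0 c' : X (Ordinal r1) c' = 0.
  apply: diag => c''; rewrite -[RHS](JX (Ordinal r1) c'').
  rewrite [RHS](bigD1 (Ordinal r1)) //= [X in _ + X]big1 ?addr0 // => b' b'0.
  by apply: big1 => d _; rewrite /jv jacobian_upper ?mulr0.
have [->|b0] := eqVneq b (Ordinal r1); first exact: X0.
apply: diag => c'; rewrite -[RHS](JX b c').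
rewrite [RHS](bigD1 b) //= [X in _ + X]big1 ?addr0 // => b' b'b.
apply: big1 => d _; have [->|b'0] := eqVneq b' (Ordinal r1).
  by rewrite X0 mul0r.
by rewrite /jv jacobian_upper ?mulr0.
Qed.

End Family.
End IntegerPoint.

(** * Identification of the family with the sets of traces *)

Section ParameterSets.
Variables (R : realType) (r : nat) (r_ge2 : (2 <= r)%N) (cs : nat).
Hypothesis cs_lt5 : (cs < 5)%N.

Definition calC : set (char_ring R r) :=
  nth set0 [:: calC1 r_ge2; calC2 r_ge2; calC3 r_ge2; calC4 r_ge2; calC5 r_ge2] cs.

Lemma range_family : range (@family R r r_ge2 cs) =
  calA r_ge2 `|` calB r_ge2 `|` calC.
Proof.
have r1 : (0 < r.-1)%N by case: (r) r_ge2 => [|[]].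
have in_range b c a : block_fun R r_ge2 cs b (c : 'I_8) = a ->
    range (@family R r r_ge2 cs) a.
  by move=> <-; exists (enum_rank (b, c)) => //; rewrite /family enum_rankK.
have laterP k : from3 k -> exists b : 'I_r.-1, k = later b /\ (0 < b)%N.
  case: k => -[|[|k]] // kr _; have kr' : (k.+1 < r.-1)%N by lia.
  by exists (Ordinal kr'); split=> //; apply: val_inj.
apply/seteqP; split=> [_ [l _ <-]|a].
  rewrite /family; case: (enum_val l) => -[[|b] br] [c c8].
    left; left; case: c c8 => [|[|[|[|[|[|[|[|//]]]]]]]] c8.
    - by do 7 left.
    - by do 6 left; right.
    - by do 5 left; right.
    - by do 4 left; right.
    - by do 3 left; right.
    - by do 2 left; right.
    - by left; right.
    - by right.
  case: c c8 => [|[|[|[|[|c]]]]] c8.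
  - by left; right; exists (later (Ordinal br)) => //; do 4 left.
  - by left; right; exists (later (Ordinal br)) => //; do 3 left; right.
  - by left; right; exists (later (Ordinal br)) => //; do 2 left; right.
  - by left; right; exists (later (Ordinal br)) => //; left; right.
  - by left; right; exists (later (Ordinal br)) => //; right.
  right; rewrite /calC; move: cs_lt5.
  case: cs => [|[|[|[|[|//]]]]] _; exists (later (Ordinal br)) => //;
    case: c c8 => [|[|[|//]]] c8; by [do 2 left | left; right | right].
case=> [[aA|[k /laterP[b [-> b0]] aB]]|].
- move: aA => [[[[[[[->|->]|->]|->]|->]|->]|->]|->].
  + exact: (in_range (Ordinal r1) (@Ordinal 8 0 isT)).
  + exact: (in_range (Ordinal r1) (@Ordinal 8 1 isT)).
  + exact: (in_range (Ordinal r1) (@Ordinal 8 2 isT)).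
  + exact: (in_range (Ordinal r1) (@Ordinal 8 3 isT)).
  + exact: (in_range (Ordinal r1) (@Ordinal 8 4 isT)).
  + exact: (in_range (Ordinal r1) (@Ordinal 8 5 isT)).
  + exact: (in_range (Ordinal r1) (@Ordinal 8 6 isT)).
  + exact: (in_range (Ordinal r1) (@Ordinal 8 7 isT)).
- case: b b0 aB => -[|b] br // _ [[[[->|->]|->]|->]|->].
  + exact: (in_range (Ordinal br) (@Ordinal 8 0 isT)).
  + exact: (in_range (Ordinal br) (@Ordinal 8 1 isT)).
  + exact: (in_range (Ordinal br) (@Ordinal 8 2 isT)).
  + exact: (in_range (Ordinal br) (@Ordinal 8 3 isT)).
  + exact: (in_range (Ordinal br) (@Ordinal 8 4 isT)).
move: in_range; rewrite /calC; move: cs_lt5.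
case: cs => [|[|[|[|[|//]]]]] _ in_range [k /laterP[b [-> b0]]];
  case: b b0 => -[|b] br // _ [[->|->]|->];
  by [ exact: (in_range (Ordinal br) (@Ordinal 8 5 isT))
     | exact: (in_range (Ordinal br) (@Ordinal 8 6 isT))
     | exact: (in_range (Ordinal br) (@Ordinal 8 7 isT)) ].
Qed.

End ParameterSets.

Theorem theorem6 (R : realType) (r : nat) (r_ge2 : (2 <= r)%N)
    (C : set (char_ring R r)) :
  (C = calC1 r_ge2 \/ C = calC2 r_ge2 \/ C = calC3 r_ge2 \/
   C = calC4 r_ge2 \/ C = calC5 r_ge2) ->
  let S : set (char_ring R r) := calA r_ge2 `|` calB r_ge2 `|` C in
  [/\ generic_local_parameters S,
      (S #= `I_(8 * r - 8)%N)%card,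
      krull_dim (char_ring R r) (8 * r - 8)%N
    & maximal_alg_independent S].
Proof.
move=> C_case S.
have [cs cs_lt5 CE] : exists2 cs, (cs < 5)%N & C = calC r_ge2 cs.
  case: C_case => [->|[->|[->|[->|->]]]].
  - by exists 0%N.
  - by exists 1%N.
  - by exists 2%N.
  - by exists 3%N.
  - by exists 4%N.
have SE : S = range (@family R r r_ge2 cs) by rewrite range_family // /S CE.
have nE : #|{: 'I_r.-1 * 'I_8}| = (8 * r - 8)%N.
  by rewrite card_prod !card_ord; lia.
(* The embedding is [restrict], the derivations are [family_derive]; injectivity of the family then
   gives the exact count 8 (r - 1). *)
have [S_generic f_inj dim_A S_max] := generic_parameters (@pchar_num R[i])
  (@complex_uncountable R) (ltac:(rewrite nE; lia) : (0 < #|{: 'I_r.-1 * 'I_8}|)%N)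
  (@restrict_inj R r r_ge2)
  (fun j => ltac:(rewrite /family_derive; case: (enum_val j) => b c;
      exact: derive_char_derivation) : derivation (@family_derive R r r_ge2 j))
  (@jacobian_family R r r_ge2 cs cs_lt5).
rewrite SE -nE; split=> //.
exact: card_eq_trans (inj_card_eq (in2W f_inj)) (card_esym card_II).
Qed.
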